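(* Let $A$ and $B$ be two unital Banach algebras, let $A\overline{\otimes}B$ be a Banach algebra that is the completion of the algebraic tensor product $A\otimes B$ with respect to a uniform crossnorm, and consider $a\in A$ and $b\in B$. Then the following statements hold. (i) $\sigma(a)=\Pi(a)=\{0\}$ or $\sigma(b)=\Pi(b)=\{0\}$ if and only if $\sigma(a\otimes b)=\Pi(a\otimes b)=\{0\}$. (ii) Suppose that neither $a$ nor $b$ is nilpotent. Then $\sigma(a)=I(a)=\{0\}$ or $\sigma(b)=I(b)=\{0\}$ if and only if $\sigma(a\otimes b)=I(a\otimes b)=\{0\}$. (iii) If $0\in\Pi(a)$ and $b$ is invertible, or if $0\in\Pi(b)$ and $a$ is invertible, or if $0\in\Pi(a)\cap\Pi(b)$, then $0\in\Pi(a\otimes b)$. (iv) If $a$ is not nilpotent, $0\in\Pi(a)$ and $0\in I(b)$, then $0\in I(a\otimes b)$. Respectively, if $b$ is not nilpotent, $0\in\Pi(b)$ and $0\in I(a)$, then $0\in I(a\otimes b)$. (v) If $b$ is invertible and $0\in I(a)$ (respectively, $a$ is invertible and $0\in I(b)$), then $0\in I(a\otimes b)$. (vi) If $0\in I(a)\cap I(b)$, then $0\in I(a\otimes b)$. (vii) If $\sigma(b)\neq\{0\}$ and $0\in\mathrm{acc}\,\sigma(a)$ (respectively, $\sigma(a)\neq\{0\}$ and $0\in\mathrm{acc}\,\sigma(b)$), then $0\in\mathrm{acc}\,\sigma(a\otimes b)$.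
   Context: Banach algebras are complex. A norm on $A\otimes B$ is a crossnorm if $\|x\otimes y\|=\|x\|\,\|y\|$ for $x\in A$, $y\in B$; it is uniform if $\|(U\otimes V)z\|\le\|U\|\,\|V\|\,\|z\|$ for all bounded linear maps $U$ on $A$, $V$ on $B$ and all $z\in A\otimes B$. The element $a\otimes b$ is regarded as an element of the Banach algebra $A\overline{\otimes}B$. For $x$ in a unital Banach algebra, $\sigma(x)$ is the usual spectrum. For $K\subseteq\mathbb{C}$, $\mathrm{iso}\,K$ is the set of isolated points of $K$ and $\mathrm{acc}\,K=K\setminus\mathrm{iso}\,K$. $\Pi(x)\subseteq\mathrm{iso}\,\sigma(x)$ is the set of poles of $x$: those $\lambda_0\in\mathrm{iso}\,\sigma(x)$ that are poles of some finite order $p\ge1$ of the resolvent function $R(\cdot,x)$, i.e. in the Laurent expansion $R(\lambda,x)=\sum_{n\ge0}a_n(\lambda-\lambda_0)^n+\sum_{n\ge1}b_n(\lambda-\lambda_0)^{-n}$ around $\lambda_0$ one has $b_p\ne0$ and $b_m=0$ for all $m\ge p+1$. Finally, $I(x)=\mathrm{iso}\,\sigma(x)\setminus\Pi(x)$. *)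

(* Defs.v *)
From HB Require Import structures.
From mathcomp Require Import all_boot all_order all_algebra.
From mathcomp Require Import complex.
From mathcomp Require Import all_classical all_reals all_analysis.

Set Implicit Arguments.
Unset Strict Implicit.
Unset Printing Implicit Defensive.

Import Order.TTheory GRing.Theory Num.Theory.
Import numFieldNormedType.Exports.

Local Open Scope classical_set_scope.
Local Open Scope ring_scope.

(* NormedModule and GRing.Algebra cannot be joined by HB (Num.NumDomain already
   inherits from Num.SemiNormedZmodule and GRing.PzSemiRing), so the norm of an
   algebra is a separate operation anorm, and the induced normed module
   structure is put on the alias normed_space. *)
HB.mixin Record Algebra_isNormed (K : numFieldType) A
    of GRing.Algebra K A := {
  anorm : A -> K;
  anormD : forall x y : A, anorm (x + y) <= anorm x + anorm y;
  anormZ : forall (l : K) (x : A), anorm (l *: x) = `|l| * anorm x;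
  anorm0_eq0 : forall x : A, anorm x = 0 -> x = 0;
  anormM : forall x y : A, anorm (x * y) <= anorm x * anorm y
}.

#[short(type="normedAlgType")]
HB.structure Definition NormedAlgebra (K : numFieldType) :=
  {A of GRing.Algebra K A & Algebra_isNormed K A}.

Definition normed_space (K : numFieldType) (A : normedAlgType K) : Type := A.

HB.instance Definition _ (K : numFieldType) (A : normedAlgType K) :=
  GRing.Lmodule.on (normed_space A).

HB.instance Definition _ (K : numFieldType) (A : normedAlgType K) :=
  Lmodule_isNormed.Build K (normed_space A)
    (@anormD K A) (@anormZ K A) (@anorm0_eq0 K A).

HB.mixin Record NormedAlgebra_isComplete (K : numFieldType) A
    of NormedAlgebra K A := {
  anorm_complete : forall F : set_system (normed_space A),
    ProperFilter F -> cauchy F -> cvg F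
}.

(* The unitAlgType structure carries no hypothesis: GRing.unit is the set of
   two-sided invertible elements.  The algebra is nonzero (1 != 0), and the
   normalization anorm 1 = 1 is not required. *)
#[short(type="banachAlgType")]
HB.structure Definition BanachAlgebra (K : numFieldType) :=
  {A of NormedAlgebra K A & GRing.UnitAlgebra K A
      & NormedAlgebra_isComplete K A}.

HB.instance Definition _ (K : numFieldType) (A : banachAlgType K) :=
  Uniform_isComplete.Build (normed_space A) (@anorm_complete K A).

Section Spectrum.
Variables (K : numFieldType) (A : banachAlgType K).
Implicit Types (x : A) (l : K).

Definition nilpotent_elt x : Prop := exists n : nat, x ^+ n = 0.

Definition spectrum x : set K := [set l | l%:A - x \isn't a GRing.unit].

(* Only meaningful off the spectrum, since GRing.inv is the identity on
   non-units. *)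
Definition resolvent x l : A := (l%:A - x)^-1.

(* [b n] is the coefficient of (l - l0)^-n for 1 <= n; [b 0] is unused. *)
Definition laurent_expansion (f : K -> A) l0 (u b : nat -> A) : Prop :=
  exists2 r : K, 0 < r & forall l, 0 < `|l - l0| < r ->
    exists s t : normed_space A,
      [/\ (fun N => \sum_(0 <= n < N) (l - l0) ^+ n *: u n : normed_space A)
            @ \oo --> s,
          (fun N => \sum_(1 <= n < N) (l - l0) ^- n *: b n : normed_space A)
            @ \oo --> t
        & f l = s + t].

Definition pole_of_order (f : K -> A) l0 (p : nat) : Prop :=
  exists u b : nat -> A,
    [/\ laurent_expansion f l0 u b, b p != 0
      & forall m, (p.+1 <= m)%N -> b m = 0].

Definition acc (S : set K) : set K := S `\` isolated S.

Definition poles x : set K :=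
  isolated (spectrum x) `&`
  [set l0 | exists2 p : nat, (1 <= p)%N & pole_of_order (resolvent x) l0 p].

Definition nonpoles x : set K := isolated (spectrum x) `\` poles x.

End Spectrum.

(* The algebraic tensor product, given by its universal property, together with
   its usual multiplication. *)
Record is_tensor_algebra (K : numFieldType) (A B AB : algType K)
    (otimes : {bilinear A -> B -> AB}) : Prop := {
  tensor_lift : forall (W : lmodType K) (f : {bilinear A -> B -> W}),
    exists g : {linear AB -> W}, forall x y, g (otimes x y) = f x y;
  tensor_ext : forall (W : lmodType K) (g h : {linear AB -> W}),
    (forall x y, g (otimes x y) = h (otimes x y)) -> forall z, g z = h z;
  tensor_mul : forall x x' y y',
    otimes x y * otimes x' y' = otimes (x * x') (y * y');
  tensor_one : otimes 1 1 = 1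
}.

Definition bounded_linear (K : numFieldType) (A B : normedAlgType K)
    (U : {linear A -> B}) : Prop :=
  bounded_near (U : normed_space A -> normed_space B) (nbhs (0 : normed_space A)).

Section Norms.
Variables (R : realType).

(* Norms take values in R[i], where they are nonnegative, hence real. *)
Definition opnorm (A B : normedAlgType R[i]) (U : A -> B) : R[i] :=
  (sup [set complex.Re (anorm (U x)) | x in [set x : A | anorm x <= 1]])%:C%C.

Variables (A B AB : normedAlgType R[i]) (otimes : {bilinear A -> B -> AB}).

Definition crossnorm : Prop :=
  forall x y, anorm (otimes x y) = anorm x * anorm y.

(* [UV] is the map U (x) V, which exists and is unique on a tensor product. *)
Definition uniform_norm : Prop :=
  forall (U : {linear A -> A}) (V : {linear B -> B}) (UV : {linear AB -> AB}),
    bounded_linear U -> bounded_linear V ->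
    (forall x y, UV (otimes x y) = otimes (U x) (V y)) ->
    forall z, anorm (UV z) <= opnorm U * opnorm V * anorm z.

Definition is_completion (T : banachAlgType R[i]) (iota : {lrmorphism AB -> T})
    : Prop :=
  (forall z, anorm (iota z) = anorm z) /\
  dense (range iota : set (normed_space T)).

End Norms.

(* Main.v *)
Require Import Defs.
From HB Require Import structures.
From mathcomp Require Import all_boot all_order all_algebra.
From mathcomp Require Import complex.
From mathcomp Require Import all_classical all_reals all_analysis.
From mathcomp Require Import ring lra.

Set Implicit Arguments.
Unset Strict Implicit.
Unset Printing Implicit Defensive.

Import Order.TTheory GRing.Theory Num.Theory.
Import numFieldNormedType.Exports.

Local Open Scope classical_set_scope.
Local Open Scope ring_scope.

(** Consider the spectral idempotent (Riesz projection) [p] of [a]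
at 0: [p] commutes with [a], [a p] is quasinilpotent, and [a] is invertible on
the range of [1 - p].  Zero is isolated in the spectrum iff such a nonzero [p]
exists, and it is a pole iff moreover [a^n p = 0] for some [n].  If [p] and [q]
belong to [a] and [b], then [1 - (1 - p) (x) (1 - q)] belongs to [a (x) b], and
a pole [a (x) b] kills [1 (x) q] by some power: this gives (i)-(vi).  For (vii), a
point [m] of [sigma(b)] of maximal modulus on a ray has approximate eigenvectors
[y] on both sides; slicing an inverse of [l m - a (x) b] with functionals norming
[y] gives approximate inverses of [l - a], so [l m] is in [sigma(a (x) b)].

No complex integration is used.  The idempotent is the limit of
[(1 - (w a)^(2^k))^-1], which is the mean of [(1 - z w a)^-1] over the [2^k]-th
roots of unity [z].  These means inherit bounds and Lipschitz constants from
[(1 - w a)^-1]; comparing them on three nearby circles shows that they converge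
geometrically to an idempotent that does not depend on the circle. *)

(** Powers of two are chosen because square roots alone produce the roots of [-1] that are needed,
    and each doubling uses just [1 - u^2 = (1 - u)(1 + u)].

    The same averages replace Cauchy's coefficient formula: [u^m / (1 - u^N)] with [m < N] is a
    weighted mean of resolvents on a circle. This bounds [a^(2^k) p], and a Liouville argument turns
    the growth of the resolvent at a pole into [a^n p = 0]. Conversely the Laurent expansion is
    explicit in [a], [p] and the generalized Drazin inverse.

    Invertible elements are the case [p = 0] and quasinilpotent ones the case [p = 1], so poles,
    invertible elements and essential singularities are treated alike. Statements (i) and (ii)
    reduce to nilpotency and quasinilpotency, which the crossnorm detects because the norm of
    [(a (x) b)^n] is the product of the norms of [a^n] and [b^n].

    In (vii) the algebras need not be commutative: one-sided approximate eigenvectors would give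
    only a one-sided inverse of [l - a], so the vectors must work on both sides at once. Uniformity
    of the norm is what makes the slice maps contractive. *)

Lemma isolated0P (K : numFieldType) (S : set K) :
  isolated S 0 <->
  S 0 /\ exists2 r : K, 0 < r & forall l, 0 < `|l| < r -> ~ S l.
Proof.
split.
  move=> [/set_mem S0 [V /nbhs_ballP[r /= r0 Ve] VS]].
  split=> //; exists r => // l /andP[l0 lr] Sl.
  have : (V `&` S) l.
    by split=> //; apply: Ve; rewrite -ball_normE /= sub0r normrN.
  by rewrite VS => /= l00; rewrite l00 normr0 ltxx in l0.
move=> [S0 [r r0 H]]; split; first exact/mem_set.
exists (ball 0 r); first exact: nbhsx_ballx.
apply/seteqP; split=> [l|l /= ->] /=.
  rewrite -ball_normE /= sub0r normrN => -[lr Sl].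
  by have [//|l0] := eqVneq l 0; case: (H l) => //; rewrite normr_gt0 l0.
by split=> //; apply: ballxx.
Qed.

(** * Real-valued norms and sequential convergence *)

Section RealNorm.
Variable R : realType.
Implicit Types (l : R[i]) (r : R).

Definition cmod l : R := complex.Re `|l|.

Lemma cmodE l : `|l| = (cmod l)%:C%C.
Proof. by rewrite /cmod RRe_real // normr_real. Qed.

Lemma cmod_ge0 l : 0 <= cmod l.
Proof. by rewrite -ler0c -cmodE. Qed.

Lemma cmod0 : cmod 0 = 0.
Proof. by apply: complexI; rewrite -cmodE normr0. Qed.

Lemma cmod1 : cmod 1 = 1.
Proof. by apply: complexI; rewrite -cmodE normr1. Qed.

Lemma cmodM l l' : cmod (l * l') = cmod l * cmod l'.
Proof. by apply: complexI; rewrite rmorphM /= -!cmodE normrM. Qed.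

Lemma cmodN l : cmod (- l) = cmod l.
Proof. by rewrite /cmod normrN. Qed.

Lemma cmodV l : cmod l^-1 = (cmod l)^-1.
Proof. by apply: complexI; rewrite fmorphV /= -!cmodE normfV. Qed.

Lemma cmodX l n : cmod (l ^+ n) = cmod l ^+ n.
Proof. by apply: complexI; rewrite rmorphXn /= -!cmodE normrX. Qed.

Lemma cmodD l l' : cmod (l + l') <= cmod l + cmod l'.
Proof. by rewrite -lecR rmorphD /= -!cmodE ler_normD. Qed.

Lemma cmodB l l' : cmod (l - l') <= cmod l + cmod l'.
Proof. by rewrite (le_trans (cmodD _ _))// cmodN. Qed.

Lemma cmod_eq0 l : (cmod l == 0) = (l == 0).
Proof. by rewrite -[RHS]normr_eq0 cmodE eq_complex /= eqxx andbT. Qed.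

Lemma cmod_gt0 l : (0 < cmod l) = (l != 0).
Proof. by rewrite lt_neqAle cmod_ge0 andbT eq_sym cmod_eq0. Qed.

Lemma cmodR r : cmod r%:C%C = `|r|.
Proof.
apply: complexI; rewrite -cmodE normc_def /=.
by rewrite expr0n /= addr0 sqrtr_sqr.
Qed.

Lemma posc_ex (e : R[i]) : 0 < e -> exists2 r, 0 < r & e = r%:C%C.
Proof.
move=> e0; have eR : e \is Num.real by rewrite ger0_real // ltW.
by exists (complex.Re e); rewrite ?RRe_real // -ltcR RRe_real.
Qed.

Section NormedAlg.
Variable A : normedAlgType R[i].
Implicit Types x y : A.

Definition rnorm x : R := complex.Re (anorm x).

Lemma rnormE x : anorm x = (rnorm x)%:C%C.
Proof.
rewrite /rnorm RRe_real // ger0_real //.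
exact: (@normr_ge0 _ (normed_space A)).
Qed.

Lemma rnorm_ge0 x : 0 <= rnorm x.
Proof. rewrite -ler0c -rnormE; exact: (@normr_ge0 _ (normed_space A)). Qed.

Lemma rnormD x y : rnorm (x + y) <= rnorm x + rnorm y.
Proof. by rewrite -lecR rmorphD /= -!rnormE anormD. Qed.

Lemma rnormM x y : rnorm (x * y) <= rnorm x * rnorm y.
Proof. by rewrite -lecR rmorphM /= -!rnormE anormM. Qed.

Lemma rnormZ l x : rnorm (l *: x) = cmod l * rnorm x.
Proof. by apply: complexI; rewrite rmorphM /= -!rnormE anormZ cmodE. Qed.

Lemma rnorm0_eq0 x : rnorm x = 0 -> x = 0.
Proof. by move=> x0; apply: (@anorm0_eq0 _ A); rewrite rnormE x0. Qed.

Lemma rnorm0 : rnorm 0 = 0.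
Proof. by rewrite -(scale0r 1) rnormZ cmod0 mul0r. Qed.

Lemma rnormN x : rnorm (- x) = rnorm x.
Proof. by rewrite -scaleN1r rnormZ cmodN cmod1 mul1r. Qed.

Lemma rnormB x y : rnorm (x - y) <= rnorm x + rnorm y.
Proof. by rewrite (le_trans (rnormD _ _))// rnormN. Qed.

Lemma rnorm_distC x y : rnorm (x - y) = rnorm (y - x).
Proof. by rewrite -rnormN opprB. Qed.

Lemma rnorm_gt0 x : (0 < rnorm x) = (x != 0).
Proof.
rewrite lt_neqAle rnorm_ge0 andbT eq_sym; congr (~~ _).
by apply/eqP/eqP => [/rnorm0_eq0//|->]; rewrite rnorm0.
Qed.

Lemma rnorm_sum n (F : nat -> A) :
  rnorm (\sum_(0 <= i < n) F i) <= \sum_(0 <= i < n) rnorm (F i).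
Proof.
elim/big_ind2: _ => // [|x1 r1 x2 r2 h1 h2]; first by rewrite rnorm0.
exact: le_trans (rnormD _ _) (lerD h1 h2).
Qed.

Lemma rnorm1_ge0 : 0 <= rnorm 1. Proof. exact: rnorm_ge0. Qed.

Lemma rnorm1_ge1 : 1 <= rnorm 1.
Proof.
have N1 : 0 < rnorm 1 by rewrite rnorm_gt0 oner_neq0.
by rewrite -(ler_pM2l N1) mulr1 -{1}(mulr1 1) rnormM.
Qed.

Lemma rnormX x n : rnorm (x ^+ n) <= rnorm x ^+ n * rnorm 1.
Proof.
elim: n => [|n IH]; first by rewrite !expr0 mul1r.
rewrite !exprS (le_trans (rnormM _ _))// -mulrA.
by rewrite ler_wpM2l // rnorm_ge0.
Qed.

Definition rcvg (u : nat -> A) x :=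
  forall e : R, 0 < e -> exists n0, forall n, (n0 <= n)%N -> rnorm (u n - x) < e.

Lemma rcvgP (u : nat -> A) x :
  ((u : nat -> normed_space A) @ \oo --> (x : normed_space A)) <-> rcvg u x.
Proof.
split=> [/cvgrPdist_lt H e e0|H].
  have e0' : 0 < e%:C%C :> R[i] by rewrite ltcR.
  have [n0 _ Hn] := H _ e0'; exists n0 => n nn.
  have := Hn n nn; rewrite /= -ltcR -rnormE rnormE rnorm_distC -rnormE; exact.
apply/cvgrPdist_lt => e /posc_ex[r r0 ->].
have [n0 Hn] := H r r0; exists n0 => // n /= nn.
have := Hn n nn; rewrite -ltcR -rnormE rnormE rnorm_distC -rnormE; exact.
Qed.

End NormedAlg.

Lemma rcauchy_cvg (A : banachAlgType R[i]) (u : nat -> A) :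
  (forall e : R, 0 < e -> exists n0, forall m n, (n0 <= m)%N -> (n0 <= n)%N ->
     rnorm (u m - u n) < e) ->
  exists x, rcvg u x.
Proof.
move=> H.
have : cvg ((u : nat -> normed_space A) @ \oo).
  apply: cauchy_cvg; apply: cauchy_exP => e /posc_ex[r r0 ->].
  have [n0 Hn] := H r r0; exists (u n0); exists n0 => // n /= nn.
  rewrite -ball_normE /=.
  have := Hn n0 n (leqnn _) nn; rewrite -ltcR -rnormE; exact.
by move=> /cvg_ex[x /rcvgP]; exists x.
Qed.

End RealNorm.

(** * Neumann series, perturbation of inverses, quasinilpotency *)

Section Resolvent.
Variables (R : realType).

Lemma exp_lt_small (q e : R) : 0 <= q < 1 -> 0 < e ->
  exists n0, forall n, (n0 <= n)%N -> q ^+ n < e.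
Proof.
move=> /andP[q0 q1] e0.
have /cvgrPdist_lt/(_ e e0)[n0 _ H] : (fun n => q ^+ n) @ \oo --> (0 : R).
  by apply: cvg_expr; rewrite ger0_norm.
by exists n0 => n /H /=; rewrite sub0r normrN ger0_norm ?exprn_ge0.
Qed.

Lemma Cexp_lt_small (C q e : R) : 0 <= q < 1 -> 0 < e ->
  exists n0, forall n, (n0 <= n)%N -> C * q ^+ n < e.
Proof.
move=> q01 e0; have C0 : 0 < `|C| + 1 by rewrite ltr_wpDl.
have [n0 H] := exp_lt_small q01 (divr_gt0 e0 C0); exists n0 => n /H.
rewrite ltr_pdivlMr // mulrC; apply: le_lt_trans.
rewrite ler_wpM2r ?exprn_ge0 //; first by case/andP: q01.
by rewrite (le_trans (ler_norm _))// lerDl.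
Qed.

Lemma le_small (x y : R) : (forall e, 0 < e -> x <= y + e) -> x <= y.
Proof. by move=> H; apply/ler_addgt0Pr. Qed.

Variable A : banachAlgType R[i].
Implicit Types (a x y p : A) (u : nat -> A).

Lemma rnorm_eq0_small x : (forall e : R, 0 < e -> rnorm x <= e) -> x = 0.
Proof.
move=> H; apply: rnorm0_eq0; apply/eqP; rewrite eq_le rnorm_ge0 andbT.
by apply: le_small => e /H; rewrite add0r.
Qed.

Lemma rcvg_unique u x y : rcvg u x -> rcvg u y -> x = y.
Proof.
move=> ux uy; apply/eqP; rewrite -subr_eq0; apply/eqP/rnorm_eq0_small => e e0.
have e2 : 0 < e / 2 by rewrite divr_gt0.
have [n1 H1] := ux _ e2; have [n2 H2] := uy _ e2.
have := H1 _ (leq_maxl n1 n2); have := H2 _ (leq_maxr n1 n2).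
set z := u _; move=> h2 h1.
rewrite -(subrKA z) (splitr e) (le_trans (rnormD _ _))// lerD // ltW //.
by rewrite rnorm_distC.
Qed.

Lemma rcvg_cst x : rcvg (fun=> x) x.
Proof. by move=> e e0; exists 0%N => n _; rewrite subrr rnorm0. Qed.

Lemma rcvg_le (C q : R) u x : 0 <= q < 1 ->
  (forall n, rnorm (u n - x) <= C * q ^+ n) -> rcvg u x.
Proof.
move=> q01 H e e0; have [n0 Hn] := Cexp_lt_small C q01 e0.
by exists n0 => n /Hn; exact: le_lt_trans (H n).
Qed.

Lemma rcvgD u v x y : rcvg u x -> rcvg v y -> rcvg (fun n => u n + v n) (x + y).
Proof.
move=> ux vy e e0; have e2 : 0 < e / 2 by rewrite divr_gt0.
have [n1 H1] := ux _ e2; have [n2 H2] := vy _ e2.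
exists (maxn n1 n2) => n; rewrite geq_max => /andP[h1 h2].
rewrite opprD addrACA (splitr e) (le_lt_trans (rnormD _ _))//.
by rewrite ltrD ?H1 ?H2.
Qed.

Lemma rcvgMl a u x : rcvg u x -> rcvg (fun n => a * u n) (a * x).
Proof.
move=> ux e e0; have a1 : 0 < rnorm a + 1 by rewrite ltr_wpDl ?rnorm_ge0.
have [n0 H] := ux _ (divr_gt0 e0 a1); exists n0 => n /H.
rewrite ltr_pdivlMr // mulrC -mulrBr => h.
apply: le_lt_trans h; rewrite (le_trans (rnormM _ _))//.
by rewrite ler_wpM2r ?rnorm_ge0 // lerDl.
Qed.

Lemma rcvgMr a u x : rcvg u x -> rcvg (fun n => u n * a) (x * a).
Proof.
move=> ux e e0; have a1 : 0 < rnorm a + 1 by rewrite ltr_wpDl ?rnorm_ge0.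
have [n0 H] := ux _ (divr_gt0 e0 a1); exists n0 => n /H.
rewrite ltr_pdivlMr // -mulrBl => h.
apply: le_lt_trans h; rewrite (le_trans (rnormM _ _))//.
by rewrite ler_wpM2l ?rnorm_ge0 // lerDl.
Qed.

Lemma rcvgM u v x y : rcvg u x -> rcvg v y -> rcvg (fun n => u n * v n) (x * y).
Proof.
move=> ux vy.
have E : x * y = 0 + x * y by rewrite add0r.
rewrite E; have -> : (fun n => u n * v n) = (fun n => (u n - x) * v n + x * v n).
  by apply/funext => n; rewrite mulrBl subrK.
apply: rcvgD; last exact: rcvgMl.
move=> e e0; have y1 : 0 < rnorm y + 1 by rewrite ltr_wpDl ?rnorm_ge0.
have [n1 H1] := ux _ (divr_gt0 e0 y1); have [n2 H2] := vy _ ltr01.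
exists (maxn n1 n2) => n; rewrite geq_max => /andP[/H1 h1 /H2 h2].
rewrite subr0 (le_lt_trans (rnormM _ _))//.
rewrite ltr_pdivlMr // in h1; apply: le_lt_trans h1.
rewrite ler_wpM2l ?rnorm_ge0 // -[v n](subrK y).
by rewrite (le_trans (rnormD _ _))// addrC lerD2l ltW.
Qed.

Lemma rcvgN u x : rcvg u x -> rcvg (fun n => - u n) (- x).
Proof.
by move=> ux e /ux[n0 H]; exists n0 => n /H; rewrite -opprD rnormN.
Qed.

Lemma rcvg_norm_le u x (C : R) n0 : rcvg u x ->
  (forall n, (n0 <= n)%N -> rnorm (u n) <= C) -> rnorm x <= C.
Proof.
move=> ux H; apply: le_small => e e0; have [n1 Hn] := ux e e0.
have := Hn _ (leq_maxr n0 n1); have := H _ (leq_maxl n0 n1).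
set z := u _; move=> h1 h2; rewrite -(subrK z x) addrC.
by rewrite (le_trans (rnormD _ _))// lerD // rnorm_distC ltW.
Qed.

Lemma geometric_rcvg (C q : R) u : 0 <= q < 1 ->
  (forall n, rnorm (u n.+1 - u n) <= C * q ^+ n) -> exists x, rcvg u x.
Proof.
move=> q01 H; have /andP[q0 q1] := q01; have q1' : 0 < 1 - q by rewrite subr_gt0.
have C0 : 0 <= C by rewrite -(mulr1 C) -(expr0 q) (le_trans (rnorm_ge0 _) (H 0%N)).
have K n m : rnorm (u (n + m)%N - u n) <= C / (1 - q) * (q ^+ n - q ^+ (n + m)).
  elim: m => [|m IH]; first by rewrite addn0 !subrr rnorm0 mulr0.
  rewrite addnS -(subrKA (u (n + m)%N)) (le_trans (rnormD _ _))//.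
  rewrite (le_trans (lerD (H _) IH)) // exprS.
  by rewrite le_eqVlt; apply/orP; left; apply/eqP; field; rewrite gt_eqF.
have K' n m : (n <= m)%N -> rnorm (u m - u n) <= C / (1 - q) * q ^+ n.
  move=> nm; rewrite -(subnKC nm) (le_trans (K _ _))// ler_wpM2l //.
    by rewrite divr_ge0 // ltW.
  by rewrite lerBlDr lerDl exprn_ge0.
apply: rcauchy_cvg => e e0.
have [n0 Hn] := Cexp_lt_small (C / (1 - q)) q01 e0.
exists n0 => m n hm hn.
wlog nm : m n hm hn / (n <= m)%N.
  by move=> W; have [/W->//|/ltnW/W] := leqP n m; rewrite rnorm_distC => ->.
by apply: le_lt_trans (Hn _ hn); exact: K'.
Qed.

Lemma neumann x : rnorm x < 1 -> 1 - x \is a GRing.unit.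
Proof.
move=> x1; have q01 : 0 <= rnorm x < 1 by rewrite rnorm_ge0.
pose u n := \sum_(i < n) x ^+ i.
have [|y uy] := @geometric_rcvg (rnorm (1 : A)) (rnorm x) u q01.
  move=> n; rewrite /u big_ord_recr /= addrC addrK mulrC; exact: rnormX.
have c0 : rcvg (fun n => 1 - x ^+ n) 1.
  apply: (@rcvg_le (rnorm (1 : A)) (rnorm x)) => // n.
  by rewrite addrC addKr rnormN mulrC rnormX.
have eL n : (1 - x) * u n = 1 - x ^+ n.
  by rewrite -[X in X - x ^+ _](expr1n A n) subrXX_comm ?/GRing.comm ?mul1r ?mulr1 //;
     congr (_ * _); apply: eq_bigr => i _; rewrite expr1n mul1r.
have eR n : u n * (1 - x) = 1 - x ^+ n.
  rewrite -eL; apply: commr_sym; apply: commr_sum => i _; apply: commr_sym.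
  by apply: commrB; [exact: commr1 | apply: commr_sym; exact: commrX].
apply/unitrP; exists y; split.
  apply: rcvg_unique c0.
  by under eq_fun do rewrite -eR; exact: rcvgMr.
apply: rcvg_unique c0.
by under eq_fun do rewrite -eL; exact: rcvgMl.
Qed.

Lemma near1_unit x : rnorm (1 - x) < 1 -> x \is a GRing.unit.
Proof. by move=> /neumann; rewrite subKr. Qed.

Lemma unit_perturb x y : x \is a GRing.unit ->
  rnorm x^-1 * rnorm (x - y) < 1 -> y \is a GRing.unit.
Proof.
move=> xu h; have -> : y = x * (1 - x^-1 * (x - y)).
  by rewrite mulrBr mulr1 mulVKr // subKr.
rewrite unitrMr // neumann // (le_lt_trans (rnormM _ _))//.
Qed.

Lemma rnormV_perturb x y : x \is a GRing.unit -> y \is a GRing.unit ->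
  rnorm (y^-1 - x^-1) <= rnorm y^-1 * rnorm (x - y) * rnorm x^-1.
Proof.
move=> xu yu; have -> : y^-1 - x^-1 = y^-1 * (x - y) * x^-1.
  by rewrite mulrBr mulrBl mulVr // mul1r mulrK.
by rewrite (le_trans (rnormM _ _))// ler_wpM2r ?rnorm_ge0 // rnormM.
Qed.

Lemma rnormV_bound x y : x \is a GRing.unit ->
  rnorm x^-1 * rnorm (x - y) <= 2^-1 ->
  y \is a GRing.unit /\ rnorm y^-1 <= 2 * rnorm x^-1.
Proof.
move=> xu h; have yu : y \is a GRing.unit.
  by apply: (unit_perturb xu); apply: le_lt_trans h _; rewrite invf_lt1 ?ltr1n.
split=> //; have hz := rnormV_perturb xu yu.
have h2 : rnorm (y^-1 - x^-1) <= 2^-1 * rnorm y^-1.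
  apply: le_trans hz _; rewrite -mulrA mulrC ler_wpM2r ?rnorm_ge0 //.
  by rewrite mulrC.
have := rnormD (y^-1 - x^-1) x^-1; rewrite subrK; lra.
Qed.

(** The geometric sum is a cofactor commuting with [1 - x]. Hence a Neumann series for one high
    power of [x] suffices to invert [1 - x]. *)
Lemma unit_1subX x n : 1 - x ^+ n \is a GRing.unit -> 1 - x \is a GRing.unit.
Proof.
have -> : 1 - x ^+ n = (1 - x) * (\sum_(i < n) x ^+ i).
  by rewrite -[X in X - x ^+ _](expr1n A n) subrXX_comm ?/GRing.comm ?mul1r ?mulr1 //;
     congr (_ * _); apply: eq_bigr => i _; rewrite expr1n mul1r.
rewrite unitrM_comm; first by case/andP.
apply: commr_sum => i _; apply: commr_sym.
by apply: commrB; [exact: commr1 | apply: commr_sym; exact: commrX].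
Qed.

(* Quasinilpotency of [x] on the range of the idempotent [p], by the root test. *)
Definition qnil x p := forall rho : R, 0 < rho ->
  exists C : R, forall n, rnorm (x ^+ n * p) <= C * rho ^+ n.

Lemma qnil_small x p (rho e : R) : qnil x p -> 0 < rho -> 0 < e ->
  exists n0, forall n, (n0 <= n)%N -> rho ^+ n * rnorm (x ^+ n * p) < e.
Proof.
move=> xq r0 e0; have r2 : 0 < rho^-1 / 2 by rewrite divr_gt0 ?invr_gt0.
have [C H] := xq _ r2.
have [|n0 Hn] := @Cexp_lt_small C (2^-1) e _ e0; first lra.
exists n0 => n /Hn; apply: le_lt_trans.
rewrite (le_trans (ler_wpM2l _ (H n))) ?exprn_ge0 ?(ltW r0) //.
by rewrite mulrCA -exprMn mulrA divff ?gt_eqF // mul1r.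
Qed.

Lemma qnil_unit1 x (l : R[i]) : qnil x 1 -> 1 - l *: x \is a GRing.unit.
Proof.
move=> xq.
have l0 : 0 < cmod l + 1 by rewrite ltr_wpDl ?cmod_ge0.
have [n0 H] := qnil_small xq l0 ltr01.
apply: (@unit_1subX _ n0); apply: neumann; rewrite exprZn rnormZ cmodX.
apply: le_lt_trans (H n0 (leqnn _)); rewrite mulr1 ler_wpM2r ?rnorm_ge0 //.
by rewrite lerXn2r ?nnegrE ?cmod_ge0 ?(ltW l0) // lerDl.
Qed.

Lemma scalar_sub_unit x (l : R[i]) : l != 0 ->
  (l%:A - x \is a GRing.unit) = (1 - l^-1 *: x \is a GRing.unit).
Proof.
move=> l0; have -> : l%:A - x = l *: (1 - l^-1 *: x).
  by rewrite scalerBr scalerA divff // scale1r.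
have lu : l%:A \is a @GRing.unit A.
  by apply/unitrP; exists (l^-1)%:A; rewrite !mulr_algl !scalerA mulVf ?divff ?scale1r.
by rewrite -mulr_algl unitrMr.
Qed.

Lemma qnil_unit x (l : R[i]) : qnil x 1 -> l != 0 -> l%:A - x \is a GRing.unit.
Proof. by move=> xq l0; rewrite scalar_sub_unit // qnil_unit1. Qed.

End Resolvent.

(** * Dyadic averages of the resolvent *)

(** Rotating [w] by such a [z] changes the sign of [(w a)^(2^k)]; this is the whole use made of
    roots of unity. *)
Lemma dyadic_root (R : realType) k : exists z : R[i], z ^+ (2 ^ k) = -1.
Proof.
elim: k => [|k [z zE]]; first by exists (-1); rewrite expr1.
by exists (sqrtc z); rewrite expnS exprM sqr_sqrtc.
Qed.

Lemma dyadic_root_cmod (R : realType) k (z : R[i]) : z ^+ (2 ^ k) = -1 -> cmod z = 1.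
Proof.
move=> zE; apply/eqP; rewrite -(@pexpr_eq1 _ _ (2 ^ k)) ?cmod_ge0 ?expn_gt0 //.
by rewrite -cmodX zE cmodN cmod1.
Qed.

(* Averaging u |-> (1 - w u)^-1 over the 2^k-th roots of unity gives
   (1 - (w u)^(2^k))^-1; only the doubling step
   (1 - u)^-1 + (1 + u)^-1 = 2 (1 - u^2)^-1 is ever used, so bounds and
   Lipschitz constants for k = 0 propagate to all k. *)
Section Annulus.
Variables (R : realType) (C : comNzRingType) (s : {rmorphism R[i] -> C}).
Variable N : C -> R.
Hypothesis N_ge0 : forall x, 0 <= N x.
Hypothesis ND : forall x y, N (x + y) <= N x + N y.
Hypothesis NM : forall x y, N (x * y) <= N x * N y.
Hypothesis NZ : forall l x, N (s l * x) = cmod l * N x.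

Let NN x : N (- x) = N x.
Proof. by rewrite -mulN1r -(rmorph1 s) -rmorphN NZ cmodN cmod1 mul1r. Qed.

Let NB x y : N (x - y) <= N x + N y.
Proof. by rewrite (le_trans (ND _ _))// NN. Qed.

Lemma bound_mul (x y : C) (b c : R) : N x <= b -> N y <= c -> N (x * y) <= b * c.
Proof. by move=> h1 h2; rewrite (le_trans (NM _ _))// ler_pM. Qed.

Lemma bound_scale (l : R[i]) (y : C) (b c : R) :
  cmod l <= b -> N y <= c -> N (s l * y) <= b * c.
Proof. by move=> h1 h2; rewrite NZ ler_pM // cmod_ge0. Qed.

Lemma bound_add (x y : C) (b c : R) : N x <= b -> N y <= c -> N (x + y) <= b + c.
Proof. by move=> h1 h2; rewrite (le_trans (ND _ _))// lerD. Qed.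

Lemma bound_sub (x y : C) (b c : R) : N x <= b -> N y <= c -> N (x - y) <= b + c.
Proof. by move=> h1 h2; rewrite (le_trans (NB _ _))// lerD. Qed.

(** Both sides equal [- e u p q]. It is applied with [u = (w a)^(2^k)] and [e = t^(2^k)], so that
    [p] and [q] are the averages at [w] and [t w], and [e] is tiny. *)
Lemma inv_relation (e u p q : C) : p * (1 - u) = 1 -> q * (1 - e * u) = 1 ->
  p * (1 - q) = e * (1 - p) * q.
Proof.
move=> hp hq; have -> : 1 - q = - (e * u) * q by rewrite -{1}hq; ring.
have -> : 1 - p = - u * p by rewrite -{1}hp; ring.
ring.
Qed.

Section Steps.
Variables (M eta : R) (e : R[i]).
Hypothesis e1 : cmod e <= 1.

Let M' := N 1 + M.

(** The two relations combine to [X (1 - (p3 - p1)) = s e * (bounded)] for [X = p2 (1 - p2)]; as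
    [p3 - p1] has size at most 1/2, the term [(p3 - p1) X] is absorbed on the left. *)
Lemma near_idempotent (p1 p2 p3 : C) :
  N p1 <= M -> N p2 <= M -> N p3 <= M -> N (p3 - p1) <= 2^-1 ->
  p1 * (1 - p2) = s e * (1 - p1) * p2 -> p2 * (1 - p3) = s e * (1 - p2) * p3 ->
  N (p2 * (1 - p2)) <= cmod e * (2 * (M * M' * M + M' * M' * M)).
Proof.
move=> h1 h2 h3 h31 r12 r23; set X := p2 * (1 - p2).
have XE : X = (p3 - p1) * X +
    s e * (p2 * (1 - p1) * p2 + (1 - p2) * (1 - p2) * p3).
  have -> : s e * (p2 * (1 - p1) * p2 + (1 - p2) * (1 - p2) * p3) =
    p2 * (s e * (1 - p1) * p2) + (1 - p2) * (s e * (1 - p2) * p3) by ring.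
  by rewrite -r12 -r23 /X; ring.
have hX : N X <= 2^-1 * N X + cmod e * (M * M' * M + M' * M' * M).
  rewrite {1}XE; apply: bound_add; first exact: bound_mul.
  apply: bound_scale => //; apply: bound_add; apply: bound_mul => //;
  by apply: bound_mul => //; apply: (bound_sub (lexx _)).
by move: hX; lra.
Qed.

(** Quantitative form of the fact that close commuting idempotents coincide: up to idempotency
    defects, the difference equals its own square times [p3], and [eta * M <= 4^-1] absorbs that
    quadratic term. *)
Lemma near_equal (B : R) (p2 p3 : C) :
  N p2 <= M -> N p3 <= M -> N (p3 - p2) <= eta -> eta * M <= 4^-1 ->
  p2 * (1 - p3) = s e * (1 - p2) * p3 ->
  N (p2 * (1 - p2)) <= B -> N (p3 * (1 - p3)) <= B ->
  N (p2 - p3) <= B * (4 * (M + (M' + M * M))).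
Proof.
move=> h2 h3 h32 eM r23 X2 X3.
set D := (1 - p2) * p3; set S := (1 - p2) * (p3 * (1 - p3)) + p2 * (1 - p2) * (p3 * p3).
have M0 : 0 <= M := le_trans (N_ge0 _) h2.
have B0 : 0 <= B := le_trans (N_ge0 _) X2.
have dE : p3 - p2 = (1 - s e) * D.
  have -> : (1 - s e) * D = D - s e * (1 - p2) * p3 by rewrite /D; ring.
  by rewrite -r23 /D; ring.
have SE : (1 - s e) * D = (p3 - p2) * D + (1 - s e) * S.
  by rewrite dE /D /S; ring.
have E : p3 - p2 = p3 * (1 - p3) * (p3 - p2) + (p3 - p2) * (p3 - p2) * p3
    + (S - s e * S).
  rewrite [LHS]dE SE; have -> : D = p3 * (1 - p3) + (p3 - p2) * p3 by rewrite /D; ring.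
  ring.
have hS : N S <= M' * B + B * (M * M).
  apply: bound_add; apply: bound_mul => //; last exact: bound_mul.
  exact: (bound_sub (lexx _)).
have h : N (p3 - p2) <= B * (2 * M) + eta * N (p3 - p2) * M
    + (M' * B + B * (M * M) + 1 * (M' * B + B * (M * M))).
  rewrite {1}E; apply: bound_add; last first.
    by apply: bound_sub => //; apply: bound_scale.
  apply: bound_add; apply: bound_mul => //.
    by have := bound_sub h3 h2; lra.
  exact: bound_mul.
have h' : eta * N (p3 - p2) * M <= 4^-1 * N (p3 - p2).
  by rewrite mulrAC ler_wpM2r.
have M'0 : 0 <= M' by rewrite addr_ge0.
have k1 := mulr_ge0 B0 M0; have k2 := mulr_ge0 B0 M'0.
have k3 := mulr_ge0 B0 (mulr_ge0 M0 M0).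
rewrite -NN opprB; lra.
Qed.

End Steps.

Variables (a : C) (W1 W2 M : R) (Q : R[i] -> C).
Let ann (w : R[i]) := W1 <= cmod w <= W2.
Hypothesis QE : forall w, ann w -> Q w * (1 - s w * a) = 1.
Hypothesis QM : forall w, ann w -> N (Q w) <= M.

Let zeta k : R[i] := sval (cid (dyadic_root R k)).
Let zetaE k : zeta k ^+ (2 ^ k) = -1. Proof. by rewrite /zeta; case: cid. Qed.
Let ann_zeta k w : ann (zeta k * w) = ann w.
Proof. by rewrite /ann cmodM (dyadic_root_cmod (zetaE k)) mul1r. Qed.

(** The roots [zeta k'] are chosen independently at each level: only [zeta k' ^+ (2 ^ k') = -1]
    matters, not that they generate one cyclic group. *)
Fixpoint dyadic_avg k w : C :=
  if k is k'.+1 then s 2^-1 * (dyadic_avg k' w + dyadic_avg k' (zeta k' * w)) else Q w.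

Let s2 : s 2^-1 * 2 = 1.
Proof. by rewrite -(rmorph_nat s 2) -rmorphM /= mulVf ?rmorph1 // pnatr_eq0. Qed.

Let cmod2 : cmod (2^-1 : R[i]) = 2^-1.
Proof.
rewrite cmodV; congr (_^-1).
have -> : (2 : R[i]) = (2%:R : R)%:C%C by rewrite rmorph_nat.
by rewrite cmodR ger0_norm.
Qed.

Lemma dyadic_avgE k w : ann w -> dyadic_avg k w * (1 - (s w * a) ^+ (2 ^ k)) = 1.
Proof.
elim: k w => [|k IH] w aw; first by rewrite expr1 QE.
have h1 := IH w aw; have := IH (zeta k * w); rewrite ann_zeta => /(_ aw).
rewrite rmorphM -mulrA exprMn -rmorphXn /= zetaE rmorphN rmorph1 expnS mulnC exprM.
rewrite /=; move: h1; set u := (s w * a) ^+ _; set p := dyadic_avg k w; set q := dyadic_avg k _.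
move=> h1 h2.
have -> : s 2^-1 * (p + q) * (1 - u ^+ 2) =
  s 2^-1 * ((p * (1 - u)) * (1 + u) + q * (1 - (-1) * u) * (1 - u)) by ring.
by rewrite h1 h2 -[RHS]s2; ring.
Qed.

Lemma dyadic_avg_bound k w : ann w -> N (dyadic_avg k w) <= M.
Proof.
elim: k w => [|k IH] w aw; first exact: QM.
have h1 := IH w aw; have := IH (zeta k * w); rewrite ann_zeta => /(_ aw) h2.
have := bound_add h1 h2; rewrite /= NZ cmod2; lra.
Qed.

Lemma dyadic_avg_lipschitz (t : R[i]) (eta : R) k w :
  (forall w, ann w -> ann (t * w) -> N (Q w - Q (t * w)) <= eta) ->
  ann w -> ann (t * w) -> N (dyadic_avg k w - dyadic_avg k (t * w)) <= eta.
Proof.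
move=> H; elim: k w => [|k IH] w aw atw; first exact: H.
have h1 := IH w aw atw.
have := IH (zeta k * w); rewrite [t * _]mulrCA !ann_zeta => /(_ aw atw) h2.
rewrite /= -mulrBr NZ cmod2 opprD addrACA; have := bound_add h1 h2; lra.
Qed.

Lemma dyadic_avg0_lipschitz (t : R) w : 0 <= t <= 1 ->
  ann w -> ann (t%:C%C * w) -> N (Q w - Q (t%:C%C * w)) <= M * ((1 - t) * W2 * N a) * M.
Proof.
move=> /andP[t0 t1] aw atw.
have -> : Q w - Q (t%:C%C * w) = Q w * (s ((1 - t)%:C%C * w) * a) * Q (t%:C%C * w).
  have -> : s ((1 - t)%:C%C * w) * a = (1 - s (t%:C%C * w) * a) - (1 - s w * a).
    by rewrite rmorphB /= mulrBl mul1r rmorphB; ring.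
  rewrite mulrBr mulrBl QE // mul1r -mulrA [_ * Q (t%:C%C * w)]mulrC QE // mulr1.
  by [].
apply: bound_mul; last exact: QM.
apply: bound_mul; first exact: QM.
apply: bound_scale => //; rewrite cmodM cmodR ger0_norm ?subr_ge0 //.
by rewrite ler_wpM2l ?subr_ge0 //; case/andP: aw.
Qed.

(** With [p = 1/(1 - u)] and [q = 1/(1 + u)], the increment [(p + q)/2 - p] is exactly
    [p (1 - p)(2 q - 1)]. So the idempotency defect also controls the speed of convergence. *)
Lemma dyadic_avg_succ k w : ann w ->
  N (dyadic_avg k.+1 w - dyadic_avg k w) <= N (dyadic_avg k w * (1 - dyadic_avg k w)) * (2 * M + N 1).
Proof.
move=> aw; have h1 := dyadic_avgE k aw.
have := @dyadic_avgE k (zeta k * w); have := @dyadic_avg_bound k (zeta k * w).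
rewrite ann_zeta => /(_ aw) h2 /(_ aw).
rewrite rmorphM -mulrA exprMn -rmorphXn /= zetaE rmorphN rmorph1.
move: h1 h2; set u := (s w * a) ^+ _; set p := dyadic_avg k w; set q := dyadic_avg k _.
move=> h1 h2 h3.
have -> : s 2^-1 * (p + q) - p = p * (1 - p) * (q + q - 1).
  have pE : 1 - p = - u * p by rewrite -{1}h1; ring.
  have E : q - p = - (u + u) * p * q.
    have <- : p * (1 - u) * q - p * (q * (1 - (-1) * u)) = q - p by rewrite h1 h3; ring.
    ring.
  have -> : s 2^-1 * (p + q) - p = s 2^-1 * (p + q) - (s 2^-1 * 2) * p by rewrite s2 mul1r.
  have -> : s 2^-1 * (p + q) - s 2^-1 * 2 * p = s 2^-1 * (q - p) by ring.
  rewrite E pE; have -> : s 2^-1 * (- (u + u) * p * q) = - (s 2^-1 * 2) * u * p * q by ring.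
  rewrite s2.
  have E1 : q + q - 1 = (1 - u) * q.
    by rewrite -{1}h3; ring.
  rewrite E1.
  have -> : p * (- u * p) * ((1 - u) * q) = - u * p * (p * (1 - u)) * q by ring.
  by rewrite h1; ring.
apply: bound_mul => //; rewrite mulr_natl mulr2n.
by apply: bound_sub => //; apply: bound_add.
Qed.

Hypothesis W1_gt0 : 0 < W1.

(** [t] is the ratio of neighbouring radii. The rate comes from the factor [t^(2^k)] in the relation
    between two circles, which is at most [t^k]. The margins [W1 < V1] and [V2 < W2] leave room for
    the auxiliary circles. *)
Lemma annulus_rates (V1 V2 : R) : W1 < V1 -> V2 < W2 -> V1 <= V2 ->
  exists t B : R, [/\ 2^-1 <= t < 1, 0 <= B,
    forall k w, V1 <= cmod w <= V2 ->
      N (dyadic_avg k w * (1 - dyadic_avg k w)) <= B * t ^+ k,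
    forall k w, V1 <= cmod w <= V2 -> N (dyadic_avg k.+1 w - dyadic_avg k w) <= B * t ^+ k
  & forall k w, V1 <= cmod w <= V2 -> V1 <= cmod (t%:C%C * w) <= V2 ->
      N (dyadic_avg k w - dyadic_avg k (t%:C%C * w)) <= B * t ^+ k].
Proof.
move=> WV1 VW2 V12.
have v10 : 0 < V1 := lt_trans W1_gt0 WV1.
have M0 : 0 <= M.
  have h : ann V1%:C%C.
    rewrite /ann cmodR ger0_norm ?(ltW v10) // (ltW WV1) /=.
    exact: le_trans V12 (ltW VW2).
  exact: le_trans (N_ge0 _) (QM h).
have W20 : 0 < W2 := lt_le_trans v10 (le_trans V12 (ltW VW2)).
pose L := M * (W2 * N a) * M.
have L0 : 0 <= L by rewrite /L !mulr_ge0 // ltW.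
(* [d = 1 - t]. One step changes an average by at most [d L], so two steps stay within the 1/2 of
   [near_idempotent]; [d L M <= 4^-1] serves [near_equal]; the last two conditions keep the
   auxiliary circles in the annulus. The reciprocal of a sum dominating all constraints meets them
   simultaneously. *)
have [d [d0 d1 dL dLM [dV1 dV2]]] : exists d : R, [/\ 0 < d, d <= 2^-1, d * L <= 4^-1,
    d * L * M <= 4^-1 & d * 3 * V1 <= V1 - W1 /\ d * W2 <= W2 - V2].
  pose c1 := V1 / (V1 - W1); pose c2 := W2 / (W2 - V2).
  have c10 : 0 < c1 by rewrite divr_gt0 // subr_gt0.
  have c20 : 0 < c2 by rewrite divr_gt0 // subr_gt0.
  have LM0 : 0 <= L * M by rewrite mulr_ge0.
  pose K := 2 + 4 * L + 4 * (L * M) + 3 * c1 + c2.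
  have K0 : 0 < K by rewrite /K; lra.
  have le c x : c <= K -> 0 < x -> x * c * K^-1 <= x.
    by move=> cK x0; rewrite -mulrA ger_pMr // ler_pdivrMr ?mul1r.
  exists K^-1; split; first by rewrite invr_gt0.
  - by rewrite lef_pV2 ?posrE // /K; lra.
  - have : 4 * L <= K by rewrite /K; lra.
    by move/le => /(_ 1 ltr01); lra.
  - have : 4 * (L * M) <= K by rewrite /K; lra.
    by move/le => /(_ 1 ltr01); lra.
  - split.
      have : 3 * c1 <= K by rewrite /K; lra.
      have x0 : 0 < V1 - W1 by lra.
      move/le => /(_ _ x0); apply: le_trans.
      by rewrite le_eqVlt; apply/orP; left; apply/eqP; rewrite /c1; field; rewrite !gt_eqF.
    have : c2 <= K by rewrite /K; lra.
    have x0 : 0 < W2 - V2 by lra.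
    move/le => /(_ _ x0); apply: le_trans.
    by rewrite le_eqVlt; apply/orP; left; apply/eqP; rewrite /c2; field; rewrite !gt_eqF.
pose t := 1 - d.
have t01 : 2^-1 <= t < 1 by rewrite /t; lra.
have t0 : 0 < t by lra.
have tn0 : t%:C%C != 0 :> R[i] by rewrite eq_complex /= eqxx andbT gt_eqF.
have ct : cmod t%:C%C = t by rewrite cmodR ger0_norm // ltW.
have step w k : ann w -> ann (t%:C%C * w) ->
    N (dyadic_avg k w - dyadic_avg k (t%:C%C * w)) <= d * L.
  apply: dyadic_avg_lipschitz => {}w aw atw.
  apply: le_trans (dyadic_avg0_lipschitz _ aw atw) _; first by lra.
  by rewrite /L /t; lra.
have rel k w : ann w -> ann (t%:C%C * w) ->
    dyadic_avg k w * (1 - dyadic_avg k (t%:C%C * w)) =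
    s (t%:C%C ^+ (2 ^ k)) * (1 - dyadic_avg k w) * dyadic_avg k (t%:C%C * w).
  move=> aw atw; apply: inv_relation (dyadic_avgE k aw) _.
  by have := dyadic_avgE k atw; rewrite rmorphM -mulrA exprMn -rmorphXn.
have ct' k : cmod (t%:C%C ^+ (2 ^ k)) <= t ^+ k.
  rewrite cmodX ct; apply: ler_wiXn2l; [lra|lra|].
  exact: ltnW (ltn_expl _ _).
pose B1 := 2 * (M * (N 1 + M) * M + (N 1 + M) * (N 1 + M) * M).
have B10 : 0 <= B1 by rewrite /B1 !(mulr_ge0, addr_ge0).
have tk0 k : 0 <= t ^+ k by rewrite exprn_ge0 // ltW.
have idem k w : ann w -> ann (t%:C%C * w) -> ann (t%:C%C^-1 * w) ->
    N (dyadic_avg k w * (1 - dyadic_avg k w)) <= B1 * t ^+ k.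
  move=> aw atw aw'.
  have E : w = t%:C%C * (t%:C%C^-1 * w) by rewrite mulVKf.
  apply: le_trans (@near_idempotent M (t%:C%C ^+ (2 ^ k)) (dyadic_avg k (t%:C%C^-1 * w)) _
    (dyadic_avg k (t%:C%C * w)) _ _ _ _ _ _) _; rewrite ?dyadic_avg_bound //.
  - have h1 := step _ k aw' (eq_ind _ ann aw _ E); have h2 := step _ k aw atw.
    rewrite -E in h1; have := bound_add h1 h2.
    rewrite subrKA -NN opprB; lra.
  - by have := rel k _ aw'; rewrite -E => /(_ aw).
  - exact: rel.
  - by rewrite mulrC -/B1 ler_wpM2l.
pose B2 := B1 * (4 * (M + ((N 1 + M) + M * M))).
pose B3 := B1 * (2 * M + N 1).
have B20 : 0 <= B2 by rewrite /B2 !(mulr_ge0, addr_ge0).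
have B30 : 0 <= B3 by rewrite /B3 !(mulr_ge0, addr_ge0).
(* Comparing [w] with [t w] needs both to be nearly idempotent, and each of these needs its two
   neighbours: hence the four circles. *)
have inner w : V1 <= cmod w <= V2 -> [/\ ann w, ann (t%:C%C * w),
    ann (t%:C%C * (t%:C%C * w)) & ann (t%:C%C^-1 * w)].
  move=> /andP[h1 h2]; rewrite /ann !cmodM cmodV ct.
  have t2 : t * V1 <= t * cmod w by rewrite ler_pM2l.
  have t3 : t * (t * V1) <= t * (t * cmod w) by rewrite !ler_pM2l.
  have t4 : t * cmod w <= cmod w by rewrite ler_piMl ?cmod_ge0 //; lra.
  have t5 : t * (t * cmod w) <= t * cmod w by rewrite ler_pM2l.
  have t6 : W1 <= t * (t * V1) by rewrite /t; nra.
  have t7 : t * (t * V1) <= t * V1 by rewrite ler_pM2l // /t; nra.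
  have t8 : cmod w <= t * W2 by rewrite /t; lra.
  have t9 : cmod w <= t^-1 * cmod w.
    by rewrite ler_peMl ?cmod_ge0 ?invf_ge1 //; lra.
  have t10 : t^-1 * cmod w <= W2 by rewrite mulrC ler_pdivrMr // mulrC.
  by split; lra.
exists t, (B1 + B2 + B3); split=> //; first lra.
- move=> k w /inner[? ? ? ?]; rewrite (le_trans (idem k w _ _ _))//.
  by rewrite ler_wpM2r //; lra.
- move=> k w /inner[aw ? ? ?]; apply: le_trans (dyadic_avg_succ _ aw) _.
  apply: le_trans (_ : B3 * t ^+ k <= _); last by rewrite ler_wpM2r //; lra.
  by rewrite /B3 mulrAC ler_wpM2r ?idem // addr_ge0 ?mulr_ge0.
- move=> k w /inner[aw atw attw aw'] _.
  apply: le_trans (_ : B2 * t ^+ k <= _); last by rewrite ler_wpM2r //; lra.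
  have E : w = t%:C%C^-1 * (t%:C%C * w) by rewrite mulKf.
  apply: le_trans (@near_equal M (d * L) (t%:C%C ^+ (2 ^ k)) _ (B1 * t ^+ k)
     _ _ _ _ _ _ _ _ _) _; rewrite ?dyadic_avg_bound //.
  - by rewrite (le_trans (ct' k))// exprn_ile1 //; lra.
  - by rewrite -NN opprB step.
  - exact: rel.
  - exact: idem.
  - by apply: idem; rewrite // -E.
  - by rewrite /B2; lra.
Qed.

End Annulus.

(** * The bicommutant as a commutative ring *)

Section Bicommutant.
Variables (K : numFieldType) (A : banachAlgType K) (a : A).

(* The bicommutant of [a]: a commutative ring containing every element that is
   built from [a] by ring operations, inverses and limits. *)
Definition bicomm : {pred A} :=
  fun x => `[< forall y, GRing.comm a y -> GRing.comm x y >].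

Lemma bicommP x :
  reflect (forall y, GRing.comm a y -> GRing.comm x y) (x \in bicomm).
Proof. exact: asboolP. Qed.

Lemma bicomm_subring : subring_closed bicomm.
Proof.
split=> [|x y /bicommP hx /bicommP hy|x y /bicommP hx /bicommP hy];
  apply/bicommP => z az; apply: commr_sym.
- exact: commr1.
- by apply: commrB; apply: commr_sym; [exact: hx|exact: hy].
- by apply: commrM; apply: commr_sym; [exact: hx|exact: hy].
Qed.

HB.instance Definition _ :=
  GRing.isSubringClosed.Build A bicomm bicomm_subring.

Lemma bicomm_self : a \in bicomm. Proof. exact/bicommP. Qed.

Lemma bicomm_scalar l : l%:A \in bicomm.
Proof. by apply/bicommP => y _; rewrite /GRing.comm mulr_algl mulr_algr. Qed.

Lemma bicomm_inv x : x \in bicomm -> x^-1 \in bicomm.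
Proof.
move=> /bicommP hx; apply/bicommP => y ay; apply: commr_sym; apply: commrV.
exact/commr_sym/hx.
Qed.

Lemma bicomm_comm x y : x \in bicomm -> y \in bicomm -> GRing.comm x y.
Proof.
move=> /bicommP hx /bicommP hy; apply: hx; apply: commr_sym; exact: hy.
Qed.

(** Packaged as a type so that the annulus estimates and identities proved by [ring] apply inside
    the noncommutative algebra [A]. *)
Record bicomm_type := Bicomm { bicomm_val : A; _ : bicomm_val \in bicomm }.

HB.instance Definition _ := [isSub for bicomm_val].
HB.instance Definition _ := [Choice of bicomm_type by <:].
HB.instance Definition _ := [SubChoice_isSubNzRing of bicomm_type by <:].

Lemma bicomm_val_inj : injective bicomm_val. Proof. exact: val_inj. Qed.

Lemma bicomm_val1 : bicomm_val 1 = 1. Proof. by []. Qed.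

Lemma bicomm_valB x y : bicomm_val (x - y) = bicomm_val x - bicomm_val y.
Proof. by []. Qed.

Lemma bicomm_valM x y : bicomm_val (x * y) = bicomm_val x * bicomm_val y.
Proof. by []. Qed.

Lemma bicomm_valX x n : bicomm_val (x ^+ n) = bicomm_val x ^+ n.
Proof. by elim: n => // n IH; rewrite !exprS bicomm_valM IH. Qed.

Lemma bicomm_mulC : commutative (@GRing.mul bicomm_type).
Proof. by move=> x y; apply: val_inj; rewrite !rmorphM; apply: bicomm_comm; exact: valP. Qed.

HB.instance Definition _ :=
  GRing.PzRing_hasCommutativeMul.Build bicomm_type bicomm_mulC.

Definition bicomm_in (l : K) : bicomm_type := Bicomm (bicomm_scalar l).

Lemma bicomm_in_additive : {morph bicomm_in : x y / x - y}.
Proof. by move=> x y; apply: val_inj; rewrite rmorphB /= scalerBl. Qed.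

Lemma bicomm_in_multiplicative : multiplicative bicomm_in.
Proof.
by split=> [x y|]; apply: val_inj; rewrite ?rmorphM /= ?rmorph1 ?scale1r // mulr_algl scalerA.
Qed.

HB.instance Definition _ :=
  GRing.isAdditive.Build K bicomm_type bicomm_in bicomm_in_additive.
HB.instance Definition _ :=
  GRing.isMultiplicative.Build K bicomm_type bicomm_in bicomm_in_multiplicative.

End Bicommutant.

(** * Convergence of the dyadic resolvents to an idempotent *)

Section SpectralLimit.
Variable R : realType.

Lemma cmodi : cmod ('i%C : R[i]) = 1.
Proof.
apply/eqP; rewrite -(@pexpr_eq1 _ _ 2) ?cmod_ge0 //.
by rewrite -cmodX sqr_i cmodN cmod1.
Qed.

Lemma cmod_Re (l : R[i]) : `|complex.Re l| <= cmod l.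
Proof. by rewrite -lecR -cmodE normc_ge_Re. Qed.

Lemma cmod_Im (l : R[i]) : `|complex.Im l| <= cmod l.
Proof.
by rewrite -normrN -ReiNIm (le_trans (cmod_Re _))// cmodM cmodi mulr1.
Qed.

Lemma cmod_le_ReIm (x y : R) : cmod (x +i* y)%C <= `|x| + `|y|.
Proof.
rewrite (complexE (x +i* y)%C) /= (le_trans (cmodD _ _))// cmodM cmodi mul1r.
by rewrite !cmodR.
Qed.

(** The disk lies in a square of real pairs, which is compact; the near-covering property is applied
    along the filter of large bounds [M]. *)
Lemma disk_uniform (G : R[i] -> R -> Prop) (W : R) :
  (forall l M M', G l M -> M <= M' -> G l M') ->
  (forall l, exists2 d : R, 0 < d & exists M, forall l', cmod (l' - l) < d -> G l' M) ->
  exists M, forall l, cmod l <= W -> G l M.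
Proof.
move=> Gmon Gloc.
have cpt : compact (`[- W, W]%classic `*` `[- W, W]%classic : set (R * R)).
  by apply: compact_setX; exact: segment_compact.
move/compact_near_coveringP : cpt.
move=> /(_ R (+oo : set_system R) (fun M z => G (z.1 +i* z.2)%C M) _).
case=> [[x y] _|M [_ HM]].
  have [d d0 [M HM]] := Gloc (x +i* y)%C.
  have d2 : 0 < d / 2 by rewrite divr_gt0.
  exists (ball (x, y) (d / 2), [set N | M <= N]) => /=.
    split; first exact: nbhsx_ballx.
    by exists M; split; [exact: num_real | move=> N; exact: ltW].
  move=> [[x' y'] N] /= [[/= hx hy] MN]; apply: Gmon MN; apply: HM.
  have -> : (x' +i* y' - x +i* y)%C = ((x' - x) +i* (y' - y))%C by [].
  rewrite (le_lt_trans (cmod_le_ReIm _ _))// (splitr d) ltrD //.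
    by rewrite distrC.
  by rewrite distrC.
exists (M + 1) => l lW.
have := HM (M + 1); rewrite ltrDl ltr01 => /(_ isT (complex.Re l, complex.Im l)).
rewrite /= (_ : (_ +i* _)%C = l); last by case: (l).
apply; split; rewrite /= in_itv /= -ler_norml.
  exact: le_trans (cmod_Re _) lW.
exact: le_trans (cmod_Im _) lW.
Qed.

Variable A : banachAlgType R[i].
Implicit Types (a p : A).

Lemma annulus_bound a (W1 W2 : R) :
  (forall w, W1 <= cmod w <= W2 -> 1 - w *: a \is a GRing.unit) ->
  exists M, forall w, W1 <= cmod w <= W2 -> rnorm (1 - w *: a)^-1 <= M.
Proof.
move=> au.
pose G (l : R[i]) M := W1 <= cmod l <= W2 -> rnorm (1 - l *: a)^-1 <= M.
have [||M HM] := @disk_uniform G W2; last first.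
- by exists M => w hw; apply: HM => //; case/andP: hw.
- move=> l; have [W1l|lW1] := leP W1 (cmod l); last first.
    exists (W1 - cmod l); first by rewrite subr_gt0.
    exists 0 => l' h /andP[h' _]; exfalso.
    by have := cmodD (l' - l) l; rewrite subrK; lra.
  have [lW2|W2l] := leP (cmod l) W2; last first.
    exists (cmod l - W2); first by rewrite subr_gt0.
    exists 0 => l' h /andP[_ h']; exfalso.
    by have := cmodB l' (l' - l); rewrite subKr; lra.
  have lu : 1 - l *: a \is a GRing.unit by apply: au; rewrite W1l.
  pose K := 2 * (rnorm (1 - l *: a)^-1 * rnorm a) + 1.
  have K0 : 0 < K by rewrite ltr_wpDl // !mulr_ge0 ?rnorm_ge0.
  exists K^-1; first by rewrite invr_gt0.
  exists (2 * rnorm (1 - l *: a)^-1) => l' h _.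
  apply: (proj2 (rnormV_bound lu _)).
  have -> : 1 - l *: a - (1 - l' *: a) = (l' - l) *: a.
    by rewrite opprB addrC addrA subrK scalerBl.
  rewrite rnormZ mulrCA.
  have : cmod (l' - l) * K <= 1 by rewrite -ler_pdivlMr // div1r ltW.
  have := mulr_ge0 (cmod_ge0 (l' - l)) (mulr_ge0 (rnorm_ge0 (1 - l *: a)^-1) (rnorm_ge0 a)).
  rewrite /K; have := cmod_ge0 (l' - l); lra.
- by move=> l M M' + MM' h => /(_ h) /le_trans; apply.
Qed.

Definition dyadic_res a (w : R[i]) k : A := (1 - (w *: a) ^+ (2 ^ k))^-1.

Lemma bicomm_dyadic_res a w k : dyadic_res a w k \in bicomm a.
Proof.
apply: bicomm_inv; rewrite rpredB ?rpred1 // rpredX // -mulr_algl rpredM //.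
  exact: bicomm_scalar.
exact: bicomm_self.
Qed.

(** The induction runs over the whole circle: in [1 - u^2 = (1 - u)(1 + u)] the second factor is the
    first one at the rotated point [z w]. *)
Lemma dyadic_unit a w k :
  (forall w' : R[i], cmod w' = cmod w -> 1 - w' *: a \is a GRing.unit) ->
  1 - (w *: a) ^+ (2 ^ k) \is a GRing.unit.
Proof.
elim: k w => [|k IH] w H; first by rewrite expr1 H.
have [z zE] := dyadic_root R k.
have h1 := IH w H; have := IH (z * w).
rewrite cmodM (dyadic_root_cmod zE) mul1r => /(_ H).
rewrite -scalerA exprZn zE scaleN1r opprK => h2.
rewrite expnS mulnC exprM -[X in X - _ ^+ 2](expr1n A 2) subrXX_comm; last first.
  by apply: commr_sym; exact: commr1.
by rewrite big_ord_recl big_ord1 /= expr1n expr0 mulr1 expr1n mul1r expr1 unitrMl.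
Qed.

(** The sum is the averaging step; the difference isolates the coefficient [(w a)^(2^k)] and is the
    source of the Cauchy estimates. *)
Lemma dyadic_res_double a (z w : R[i]) k : z ^+ (2 ^ k) = -1 ->
  (forall w' : R[i], cmod w' = cmod w -> 1 - w' *: a \is a GRing.unit) ->
  dyadic_res a w k + dyadic_res a (z * w) k = 2 *: dyadic_res a w k.+1 /\
  dyadic_res a w k - dyadic_res a (z * w) k = 2 *: ((w *: a) ^+ (2 ^ k) * dyadic_res a w k.+1).
Proof.
move=> zE H; have h1 := dyadic_unit k H; have h3 := dyadic_unit k.+1 H.
have /dyadic_unit h2 : forall w', cmod w' = cmod (z * w) -> 1 - w' *: a \is a GRing.unit.
  by move=> w'; rewrite cmodM (dyadic_root_cmod zE) mul1r; exact: H.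
have {h2} := h2 k; rewrite /dyadic_res -scalerA exprZn zE scaleN1r opprK.
move: h1 h3; rewrite expnS [(2 * _)%N]mulnC exprM; set u := (w *: a) ^+ _.
move=> h1 h3 h2.
have E : 1 - u ^+ 2 = (1 - u) * (1 + u).
  by rewrite mulrBl mul1r mulrDr mulr1 -expr2 addrKA.
have E' : 1 - u ^+ 2 = (1 + u) * (1 - u).
  by rewrite mulrDl mul1r mulrBr mulr1 -expr2 addrA subrK.
have Vl : (1 - u)^-1 = (1 + u) / (1 - u ^+ 2).
  by apply: (mulrI h1); rewrite mulrV // mulrA -E mulrV.
have Vr : (1 + u)^-1 = (1 - u) / (1 - u ^+ 2).
  by apply: (mulrI h2); rewrite mulrV // mulrA -E' mulrV.
rewrite Vl Vr -mulrDl -mulrBl; split.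
  by rewrite addrACA subrr addr0 -mulr2n -scaler_nat -scalerAl mul1r.
by rewrite opprB addrACA [u + _]addrC addrACA subrr add0r -mulr2n -scaler_nat -scalerAl.
Qed.

(** The annulus estimates are read in the bicommutant, where the average and [dyadic_res] agree
    because both invert [1 - (w a)^(2^k)]. *)
Lemma dyadic_res_rates a (W1 V1 V2 W2 : R) :
  (forall w, W1 <= cmod w <= W2 -> 1 - w *: a \is a GRing.unit) ->
  0 < W1 -> W1 < V1 -> V2 < W2 -> V1 <= V2 ->
  exists t B : R, [/\ 2^-1 <= t < 1, 0 <= B,
    forall k w, V1 <= cmod w <= V2 ->
      rnorm (dyadic_res a w k * (1 - dyadic_res a w k)) <= B * t ^+ k,
    forall k w, V1 <= cmod w <= V2 ->
      rnorm (dyadic_res a w k.+1 - dyadic_res a w k) <= B * t ^+ k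
  & forall k w, V1 <= cmod w <= V2 -> V1 <= cmod (t%:C%C * w) <= V2 ->
      rnorm (dyadic_res a w k - dyadic_res a (t%:C%C * w) k) <= B * t ^+ k].
Proof.
move=> au W10 WV1 VW2 V12; have [M HM] := annulus_bound au.
have Qin w : (1 - w *: a)^-1 \in bicomm a.
  by have := bicomm_dyadic_res a w 0; rewrite /dyadic_res expr1.
pose C := bicomm_type a; pose s : {rmorphism R[i] -> C} := @bicomm_in _ _ a.
pose aa : C := Bicomm (bicomm_self a).
pose Q w : C := Bicomm (Qin w).
pose N (x : C) := rnorm (bicomm_val x).
have sa w : bicomm_val (s w * aa) = w *: a by rewrite bicomm_valM /= mulr_algl.
have QE w : W1 <= cmod w <= W2 -> Q w * (1 - s w * aa) = 1.
  move=> hw; apply: bicomm_val_inj; rewrite bicomm_valM bicomm_valB sa bicomm_val1 /=.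
  by rewrite mulVr // au.
have N0 x : 0 <= N x by exact: rnorm_ge0.
have ND x y : N (x + y) <= N x + N y by exact: rnormD.
have NM x y : N (x * y) <= N x * N y by exact: rnormM.
have NZ l x : N (s l * x) = cmod l * N x by rewrite /N bicomm_valM /= mulr_algl rnormZ.
have [t [B [t1 B0 H1 H2 H3]]] := annulus_rates N0 ND NM NZ QE HM W10 WV1 VW2 V12.
have E w k : V1 <= cmod w <= V2 -> bicomm_val (dyadic_avg s Q k w) = dyadic_res a w k.
  move=> /andP[h1 h2]; have aw : W1 <= cmod w <= W2.
    by rewrite (le_trans (ltW WV1) h1) (le_trans h2 (ltW VW2)).
  have := dyadic_avgE QE k aw => /(congr1 (@bicomm_val _ _ a)).
  rewrite bicomm_valM bicomm_valB bicomm_valX sa bicomm_val1 => h.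
  have h' : (1 - (w *: a) ^+ (2 ^ k)) * bicomm_val (dyadic_avg s Q k w) = 1.
    rewrite -[RHS]h; apply: bicomm_comm; last exact: valP.
    rewrite rpredB ?rpred1 // rpredX // -sa; exact: valP.
  have u : 1 - (w *: a) ^+ (2 ^ k) \is a GRing.unit.
    by apply/unitrP; exists (bicomm_val (dyadic_avg s Q k w)).
  by apply: (mulIr u); rewrite h mulVr.
exists t, B; split=> // k w hw.
- by rewrite -E // -(bicomm_val1 a) -bicomm_valB -bicomm_valM; exact: H1.
- by rewrite -!E // -bicomm_valB; exact: H2.
- by move=> htw; rewrite -!E // -bicomm_valB; exact: H3.
Qed.

(* The limit is the Riesz idempotent of [a] for the part of the spectrum inside
   the circle of radius [1 / V]; it does not depend on the radius. *)
Lemma riesz_limit a (W V : R) : 0 < W -> W < V ->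
  (forall w : R[i], W <= cmod w -> 1 - w *: a \is a GRing.unit) ->
  exists p, [/\ p * p = p, p \in bicomm a, rcvg (dyadic_res a V%:C%C) p
    & forall w1 : R, exists2 w : R, w1 <= w & rcvg (dyadic_res a w%:C%C) p].
Proof.
move=> W0 WV au.
have au' W' w : W <= cmod w <= W' -> 1 - w *: a \is a GRing.unit by case/andP=> /au.
have V0 : 0 < V := lt_trans W0 WV.
have cV : cmod V%:C%C = V by rewrite cmodR ger0_norm // ltW.
have [p pV] : exists p, rcvg (dyadic_res a V%:C%C) p.
  have VV : V < V + 1 by rewrite ltrDl.
  have [t [B [/andP[t1 t2] B0 _ H _]]] := dyadic_res_rates (@au' (V + 1)) W0 WV VV (lexx _).
  apply: (@geometric_rcvg _ _ B t); first by rewrite t2 (le_trans _ t1) ?invr_ge0.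
  by move=> n; apply: H; rewrite cV lexx.
have pp : p * p = p.
  have VV : V < V + 1 by rewrite ltrDl.
  have [t [B [/andP[t1 t2] B0 H _ _]]] := dyadic_res_rates (@au' (V + 1)) W0 WV VV (lexx _).
  have t01 : 0 <= t < 1 by rewrite t2 (le_trans _ t1) ?invr_ge0.
  apply/eqP; rewrite eq_sym -subr_eq0 -{1}[p]mulr1 -mulrBr; apply/eqP.
  apply: rcvg_unique (_ : rcvg _ 0); first exact: rcvgM pV (rcvgD (rcvg_cst 1) (rcvgN pV)).
  apply: (@rcvg_le _ _ B t) => // n; rewrite subr0; apply: H.
  by rewrite cV lexx.
have pb : p \in bicomm a.
  apply/bicommP => y ay; rewrite /GRing.comm.
  apply: rcvg_unique (rcvgMr y pV) _.
  have := rcvgMl y pV; congr rcvg; apply/funext => k.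
  by have /bicommP/(_ y ay) := bicomm_dyadic_res a V%:C%C k.
exists p; split=> // w1.
wlog w1V : w1 / V <= w1.
  move=> H; have [/H//|/ltW w1V] := leP V w1.
  by have [w h1 h2] := H V (lexx _); exists w => //; exact: le_trans h1.
have w10 : 0 < w1 := lt_le_trans V0 w1V.
have VV : 2 * w1 < 2 * w1 + 1 by rewrite ltrDl.
have V2 : V <= 2 * w1 by lra.
have [t [B [/andP[t1 t2] B0 _ _ H]]] := dyadic_res_rates (@au' (2 * w1 + 1)) W0 WV VV V2.
have t0 : 0 < t by rewrite (lt_le_trans _ t1) // invr_gt0.
have t01 : 0 <= t < 1 by rewrite t2 ltW.
(* The radii [V t^-i] climb from [V]; at the least [j] passing [w1] they have not passed [2 w1],
   because [t >= 1/2] means that one step at most doubles the radius. *)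
pose P j := w1 <= V * t ^- j.
have exP : exists j, P j.
  have [j Hj] := exp_lt_small t01 (divr_gt0 V0 w10).
  exists j; rewrite /P ler_pdivlMr ?exprn_gt0 // mulrC -ler_pdivlMr // ltW //.
  exact: Hj.
pose j := ex_minn exP; have [Pj minj] : P j /\ forall i, P i -> (j <= i)%N.
  by rewrite /j; case: ex_minnP.
have hj i : (i <= j)%N -> V <= V * t ^- i <= 2 * w1.
  case: i => [|i] ij; first by rewrite expr0 invr1 mulr1 lexx V2.
  have nP : ~~ P i by apply/negP => /minj; rewrite leqNgt ij.
  have h1 : 1 <= t ^- i.+1 by rewrite invf_ge1 ?exprn_gt0 // exprn_ile1 // ltW.
  rewrite ler_peMr ?(ltW V0) //=.
  rewrite exprSr invfM mulrA.
  have h2 : t^-1 <= 2 by rewrite -[2]invrK lef_pV2 ?posrE // invr_gt0.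
  have h3 : V * t ^- i <= w1 by apply: ltW; rewrite ltNge.
  rewrite mulrC; apply: ler_pM => //; first by rewrite invr_ge0 ltW.
  by rewrite mulr_ge0 ?(ltW V0) // invr_ge0 exprn_ge0 // ltW.
exists (V * t ^- j) => //.
(* Each step costs [B t^k] and [j] is fixed, so the accumulated difference still tends to 0 as [k]
   grows. *)
suff K i k : (i <= j)%N ->
    rnorm (dyadic_res a (V * t ^- i)%:C%C k - dyadic_res a V%:C%C k) <= i%:R * B * t ^+ k.
  move=> e e0; have e2 : 0 < e / 2 by rewrite divr_gt0.
  have [n1 Hn1] := pV _ e2; have [n2 Hn2] := Cexp_lt_small (j%:R * B) t01 e2.
  exists (maxn n1 n2) => n; rewrite geq_max => /andP[h1 h2].
  rewrite -(subrKA (dyadic_res a V%:C%C n)) (splitr e) (le_lt_trans (rnormD _ _))//.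
  by rewrite ltrD ?Hn1 // (le_lt_trans (K _ _ (leqnn _))) ?Hn2.
elim: i => [|i IH] ij; first by rewrite expr0 invr1 mulr1 subrr rnorm0 mul0r mul0r.
have ij' := ltnW ij; have := IH ij'.
have hi := hj _ ij; have hi' := hj _ ij'.
have E : (V * t ^- i)%:C%C = t%:C%C * (V * t ^- i.+1)%:C%C :> R[i].
  rewrite -rmorphM /=; congr (_%:C)%C; rewrite exprSr invfM mulrCA; congr (_ * _).
  by rewrite mulrCA mulfV ?mulr1 // gt_eqF.
have c i' : (i' <= j)%N -> cmod (V * t ^- i')%:C%C = V * t ^- i'.
  by move=> /hj/andP[h _]; rewrite cmodR ger0_norm // (le_trans (ltW V0) h).
have := H k (V * t ^- i.+1)%:C%C; rewrite -E !c // => /(_ hi hi') h1 h2.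
rewrite -(subrKA (dyadic_res a (V * t ^- i)%:C%C k)) (le_trans (rnormD _ _))//.
by rewrite (le_trans (lerD h1 h2)) // -addn1 natrD; lra.
Qed.

End SpectralLimit.

(** * Spectral idempotents and poles *)

Section SpectralIdempotent.
Variables (R : realType) (A : banachAlgType R[i]).
Implicit Types (a p x y : A).

Lemma rcvg_inv1 (y : nat -> A) : rcvg y 1 -> rcvg (fun n => (y n)^-1) 1.
Proof.
move=> y1 e e0; pose N1 := rnorm (1 : A).
have N10 : 0 < N1 := lt_le_trans ltr01 (rnorm1_ge1 A).
pose q := Num.min (2 * N1)^-1 (e / (2 * N1 * N1)).
have q0 : 0 < q.
  by rewrite lt_min invr_gt0 mulr_gt0 //= divr_gt0 // !mulr_gt0.
have [n0 H] := y1 q q0; exists n0 => n /H; rewrite lt_min rnorm_distC => /andP[h1 h2].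
have [||yu yb] := @rnormV_bound _ A 1 (y n); first exact: unitr1.
  by rewrite invr1 -/N1 mulrC -ler_pdivlMr // -invfM ltW.
apply: le_lt_trans (_ : 2 * N1 * N1 * rnorm (1 - y n) < _); last first.
  by rewrite mulrC -ltr_pdivlMr // !mulr_gt0.
have := rnormV_perturb (unitr1 A) yu; rewrite invr1 => /le_trans; apply.
rewrite invr1 in yb.
have := ler_wpM2r (mulr_ge0 (rnorm_ge0 (1 - y n)) (ltW N10)) yb; rewrite -/N1; lra.
Qed.

Lemma pow_bound x (rho : R) m : 0 < rho -> (0 < m)%N -> rnorm (x ^+ m) <= rho ^+ m ->
  exists C : R, forall n, rnorm (x ^+ n) <= C * rho ^+ n.
Proof.
move=> r0 m0 hm; exists (\sum_(i < m) rnorm (x ^+ i) / rho ^+ i).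
elim/ltn_ind => n IH; have [nm|mn] := ltnP n m.
  rewrite -ler_pdivrMr ?exprn_gt0 // (bigD1 (Ordinal nm)) //= lerDl sumr_ge0 // => i _.
  by rewrite divr_ge0 ?rnorm_ge0 // exprn_ge0 // ltW.
rewrite -(subnKC mn) !exprD (le_trans (rnormM _ _))// mulrCA ler_pM ?rnorm_ge0 //.
by apply: IH; rewrite ltn_subrL m0 (leq_trans m0).
Qed.

(** Stands in for the spectral radius formula. On a small circle the dyadic resolvents tend to 1, so
    the idempotent is 1; the same limit on arbitrarily large circles then forces [(w a)^(2^k)] to
    tend to 0. *)
Lemma spectrum_sub0_qnil a :
  (forall l, l != 0 -> l%:A - a \is a GRing.unit) -> qnil a 1.
Proof.
move=> au.
have au' w : 1 - w *: a \is a GRing.unit.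
  have [->|w0] := eqVneq w 0; first by rewrite scale0r subr0 unitr1.
  by rewrite -[w]invrK -scalar_sub_unit ?invr_eq0 // au // invr_eq0.
have Na : 0 < 2 * (rnorm a + 1) by rewrite mulr_gt0 // ltr_wpDl ?rnorm_ge0.
(* This radius makes the norm of [V a] at most 1/2, so [(V a)^(2^k)] tends to 0. *)
pose V := (2 * (rnorm a + 1))^-1; have V0 : 0 < V by rewrite invr_gt0.
have hW : 0 < V / 2 by rewrite divr_gt0.
have hV : V / 2 < V by rewrite ltr_pdivrMr // mulr_natr mulr2n ltrDl.
have [p [_ _ pV pw]] := riesz_limit hW hV (fun w _ => au' w).
have p1 : p = 1.
  apply: rcvg_unique pV _; apply: rcvg_inv1.
  apply: (@rcvg_le _ _ (rnorm (1 : A)) 2^-1); first lra.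
  move=> k; rewrite addrC addKr rnormN (le_trans (rnormX _ _))// mulrC.
  rewrite ler_wpM2l ?rnorm_ge0 // rnormZ cmodR (ger0_norm (ltW V0)).
  have h : V * rnorm a <= 2^-1.
    by rewrite /V mulrC ler_pdivrMr // mulrA mulVf ?mul1r ?lerDl // pnatr_eq0.
  have h0 : 0 <= V * rnorm a by rewrite mulr_ge0 ?rnorm_ge0 // ltW.
  apply: le_trans (_ : 2^-1 ^+ (2 ^ k) <= _); first by rewrite lerXn2r ?nnegrE.
  by apply: ler_wiXn2l; [lra|lra|exact: ltnW (ltn_expl _ _)].
rewrite p1 in pw => rho rho0.
have [w hw /rcvg_inv1 cw] := pw rho^-1.
have w0 : 0 < w by rewrite (lt_le_trans _ hw) // invr_gt0.
have [k /(_ k (leqnn _))] := cw 1 ltr01.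
rewrite invrK addrC addKr rnormN exprZn rnormZ -rmorphXn cmodR ger0_norm; last first.
  by rewrite exprn_ge0 // ltW.
move=> /ltW hk; have [||C HC] := @pow_bound a rho (2 ^ k) rho0.
- by rewrite expn_gt0.
- have wr : 1 <= w ^+ (2 ^ k) * rho ^+ (2 ^ k).
    by rewrite -exprMn exprn_ege1 // -ler_pdivrMr // div1r.
  have wk : 0 < w ^+ (2 ^ k) by rewrite exprn_gt0.
  by rewrite -(ler_pM2l wk) (le_trans hk).
- by exists C => n; rewrite mulr1.
Qed.

(* [d] is the generalized Drazin inverse of [a]. *)
Definition spectral_idem a p := [/\ p * p = p, GRing.comm a p, qnil a p
  & exists d, [/\ a * d = 1 - p, d * a = 1 - p, d * p = 0 & p * d = 0]].

Lemma comm_idem_exp a p n : GRing.comm a p -> p * p = p ->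
  (a * p) ^+ n * p = a ^+ n * p.
Proof.
move=> ap pp; rewrite exprMn_comm // -mulrA; congr (_ * _).
by elim: n => [|n IH]; rewrite ?expr0 ?mul1r // exprS -mulrA IH.
Qed.

Lemma qnil_mul_idem a p : GRing.comm a p -> p * p = p -> qnil a p -> qnil (a * p) 1.
Proof.
move=> ap pp qp rho r0; have [C HC] := qp rho r0.
exists (C + rnorm (1 : A)) => n; rewrite mulr1.
have rn : 0 <= rho ^+ n by rewrite exprn_ge0 // ltW.
case: n rn => [|n] rn.
  rewrite !expr0 mulr1 lerDr.
  by have := le_trans (rnorm_ge0 _) (HC 0%N); rewrite mulr1.
have -> : (a * p) ^+ n.+1 = a ^+ n.+1 * p.
  by rewrite -comm_idem_exp // exprSr -!mulrA pp.
by rewrite (le_trans (HC _))// ler_wpM2r // lerDl rnorm_ge0.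
Qed.

(** Here [H] approximates an inverse of [a] on the range of [1 - p]; the right side then
    approximates [1 + a p], exhibiting [a + p] as a factor of a unit. *)
Lemma idem_corner_inverse (C : comNzRingType) (a p H : C) : p * p = p ->
  (a + p) * (H * (1 - p) + p) = a * H * (1 - p) + a * p + p.
Proof.
move=> pp; have -> : (a + p) * (H * (1 - p) + p) =
  a * H * (1 - p) + a * p + H * (p - p * p) + p * p by ring.
by rewrite pp subrr mulr0 addr0.
Qed.

(** Here [H] approximates an inverse of [1 - x] on the range of [p]; the right side is then close to
    1, exhibiting [1 - x p] as a factor of a unit. *)
Lemma idem_corner_factor (C : comNzRingType) (x p H : C) : p * p = p ->
  (1 - x * p) * (H * p + (1 - p)) = (1 - x) * H * p + (1 - p).
Proof.
move=> pp; have -> : (1 - x * p) * (H * p + (1 - p)) =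
  H * p - x * H * (p * p) + (1 - p) - x * (p - p * p) by ring.
by rewrite pp subrr mulr0; ring.
Qed.

Lemma isolated_spectral_idem a (delta : R) : 0 < delta ->
  (forall l, 0 < cmod l < delta -> l%:A - a \is a GRing.unit) ->
  exists p, spectral_idem a p.
Proof.
(* For [|w| >= W] the point [1/w] has modulus at most [delta / 2], strictly inside the punctured
   disk. *)
move=> d0 au; pose W := 2 / delta.
have W0 : 0 < W by rewrite divr_gt0.
have au' w : W <= cmod w -> 1 - w *: a \is a GRing.unit.
  move=> hw; have w0 : w != 0 by rewrite -cmod_gt0 (lt_le_trans W0).
  have cw : 0 < cmod w by rewrite cmod_gt0.
  rewrite -[w]invrK -scalar_sub_unit ?invr_eq0 // au // cmodV invr_gt0 cw /=.
  apply: le_lt_trans (_ : W^-1 < _); first by rewrite lef_pV2 ?posrE.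
  by rewrite /W invf_div ltr_pdivrMr // mulr_natr mulr2n ltrDl.
have WV : W < W + 1 by rewrite ltrDl.
have [p [pp pb pV pw]] := riesz_limit W0 WV au'.
have ab := bicomm_self a.
have V0 : 0 < W + 1 := lt_trans W0 WV.
have ap : GRing.comm a p by apply: bicomm_comm ab pb.
have qap : qnil (a * p) 1.
  apply: spectrum_sub0_qnil => l l0; rewrite scalar_sub_unit //.
  have cl : 0 < cmod l by rewrite cmod_gt0.
  have [w hw cw] := pw (Num.max W (2 / cmod l)).
  move: hw; rewrite ge_max => /andP[hW hl].
  have w0 : 0 < w := lt_le_trans W0 hW.
  have hwl : 2 <= w * cmod l by rewrite -ler_pdivrMr.
  (* [S k] times the dyadic resolvent [P_k] approximates [(1 - x)^-1] on the range of [p]: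
     [(1 - x) S_k P_k = P_k - x^(2^k) P_k], where the last term equals [(w l)^-(2^k) (P_k - 1)] and
     vanishes in the limit since [|w l| >= 2]. *)
  pose x := l^-1 *: a; pose S k := \sum_(i < 2 ^ k) x ^+ i.
  have xb : x \in bicomm a by rewrite /x -mulr_algl rpredM // bicomm_scalar.
  have Sb k : S k \in bicomm a by rewrite rpred_sum // => i _; rewrite rpredX.
  have Pb k : dyadic_res a w%:C%C k \in bicomm a := bicomm_dyadic_res _ _ _.
  have SE k : (1 - x) * S k = 1 - x ^+ (2 ^ k).
    rewrite -[X in X - x ^+ _](expr1n A (2 ^ k)) subrXX_comm; last first.
      by apply: commr_sym; exact: commr1.
    by congr (_ * _); apply: eq_bigr => i _; rewrite expr1n mul1r.
  have cv : rcvg (fun k => (1 - x) * (S k * dyadic_res a w%:C%C k) * p + (1 - p)) 1.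
    have E1 : 1 = (p - 0) * p + (1 - p) by rewrite subr0 pp addrC subrK.
    rewrite [X in rcvg _ X]E1.
    apply: rcvgD (rcvg_cst _); apply: rcvgMr.
    have -> : (fun k => (1 - x) * (S k * dyadic_res a w%:C%C k)) =
      (fun k => dyadic_res a w%:C%C k - x ^+ (2 ^ k) * dyadic_res a w%:C%C k).
      by apply/funext => k; rewrite mulrA SE mulrBl mul1r.
    apply: (rcvgD cw _); apply: rcvgN.
    have [n1 Hn1] := cw 1 ltr01.
    have xE k : x ^+ (2 ^ k) * dyadic_res a w%:C%C k =
        (w%:C%C * l) ^- (2 ^ k) *: (dyadic_res a w%:C%C k - 1).
      have wu : 1 - (w%:C%C *: a) ^+ (2 ^ k) \is a GRing.unit.
        apply: dyadic_unit => w' ew; apply: au'.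
        by rewrite ew cmodR ger0_norm // ltW.
      have -> : dyadic_res a w%:C%C k - 1 = (w%:C%C *: a) ^+ (2 ^ k) * dyadic_res a w%:C%C k.
        by rewrite -[X in _ - X](mulrV wu) -/(dyadic_res _ _ _) mulrBl mul1r subKr.
      rewrite !exprZn -!scalerAl !scalerA; congr (_ *: _).
      rewrite exprMn invfM mulrAC mulVf ?mul1r -?exprVn //.
      by rewrite expf_neq0 // eq_complex /= eqxx andbT gt_eqF.
    move=> e e0.
    have hh : 0 <= (2^-1 : R) < 1 by lra.
    have [n2 Hn2] := Cexp_lt_small (rnorm p + rnorm (1 : A) + 1) hh e0.
    exists (maxn n1 n2) => k; rewrite geq_max => /andP[/Hn1 h1 /Hn2 h2].
    rewrite subr0 xE rnormZ cmodV cmodX cmodM cmodR ger0_norm ?(ltW w0) //.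
    apply: le_lt_trans h2; rewrite mulrC; apply: ler_pM; rewrite ?rnorm_ge0 //.
    - by rewrite invr_ge0 exprn_ge0 // mulr_ge0 ?cmod_ge0 // ltW.
    - rewrite -[dyadic_res _ _ _](subrK p) -addrA (le_trans (rnormD _ _))//.
      by rewrite [leLHS]addrC; apply: lerD (rnormB _ _) (ltW h1).
    - rewrite -exprVn; apply: le_trans (_ : 2^-1 ^+ (2 ^ k) <= _).
        rewrite lerXn2r ?nnegrE ?invr_ge0 //.
          by rewrite mulr_ge0 ?cmod_ge0 // ltW.
        by rewrite lef_pV2 ?posrE // mulr_gt0.
      by apply: ler_wiXn2l; [lra|lra|exact: ltnW (ltn_expl _ _)].
  have [k /(_ k (leqnn _))] := cv 1 ltr01.
  rewrite rnorm_distC => /near1_unit.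
  have SPb : S k * dyadic_res a w%:C%C k \in bicomm a by apply: rpredM; [exact: Sb | exact: Pb].
  have := @idem_corner_factor (bicomm_type a) (Bicomm xb) (Bicomm pb) (Bicomm SPb).
  have ppC : Bicomm pb * Bicomm pb = Bicomm pb :> bicomm_type a.
    by apply: bicomm_val_inj.
  move=> /(_ ppC) /(congr1 (@bicomm_val _ _ a)).
  rewrite !(bicomm_valM, bicomm_valB, bicomm_val1) /= => <-.
  rewrite unitrM_comm; first by rewrite -scalerAl => /andP[].
  apply: (@bicomm_comm _ _ a).
    by rewrite rpredB ?rpred1 // rpredM.
  by rewrite rpredD ?rpredB ?rpred1 // rpredM.
have qp : qnil a p.
  move=> rho r0; have [C HC] := qap rho r0; exists (C * rnorm p) => n.
  rewrite -comm_idem_exp // (le_trans (rnormM _ _))// mulrAC ler_wpM2r ?rnorm_ge0 //.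
  by have := HC n; rewrite mulr1.
exists p; split=> //.
(* On the range of [p] the sum is 1 plus a quasinilpotent, on the complement it is [a]; its inverse
   cut down to the complement is the required [d]. *)
have apu : a + p \is a GRing.unit.
  have v1 : 1 + a * p \is a GRing.unit.
    by have := qnil_unit1 (-1) qap; rewrite scaleN1r opprK.
  pose P := dyadic_res a (W + 1)%:C%C.
  (* One factor [a] is removed from [1 - P k = - (V a)^(2^k) P k], with [V = W + 1], so that
     [a * H k] tends to [1 - p]. *)
  pose H k := - (W + 1)%:C%C *: (((W + 1)%:C%C *: a) ^+ (2 ^ k).-1 * P k).
  have HE k : a * H k = 1 - P k.
    have wu : 1 - ((W + 1)%:C%C *: a) ^+ (2 ^ k) \is a GRing.unit.
      apply: dyadic_unit => w' ew; apply: au'.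
      by rewrite ew cmodR ger0_norm ltW.
    rewrite -[X in X - _](mulrV wu) -/(P k) mulrBl mul1r addrAC subrr sub0r.
    rewrite /H -scalerAr scaleNr scalerAl mulrA -exprS.
    by rewrite prednK // expn_gt0.
  have cv : rcvg (fun k => a * H k * (1 - p) + (a * p + p)) (1 + a * p).
    have E1 : 1 + a * p = (1 - p) * (1 - p) + (a * p + p).
      rewrite mulrBr mulr1 mulrBl mul1r pp subrr subr0.
      by rewrite [a * p + p]addrC addrA subrK.
    rewrite [X in rcvg _ X]E1; apply: rcvgD (rcvg_cst _); apply: rcvgMr.
    under eq_fun do rewrite HE.
    by apply: rcvgD (rcvg_cst _) _; apply: rcvgN.
  have K0 : 0 < rnorm (1 + a * p)^-1
    by rewrite rnorm_gt0 invr_eq0; apply: contraTneq v1 => ->; rewrite unitr0.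
  have [k /(_ k (leqnn _))] := cv _ (divr_gt0 ltr01 K0).
  rewrite rnorm_distC ltr_pdivlMr // mulrC => /(unit_perturb v1).
  have Hb : H k \in bicomm a.
    have wab : (W + 1)%:C%C *: a \in bicomm a.
      by rewrite -mulr_algl rpredM // bicomm_scalar.
    rewrite /H -mulr_algl; apply: rpredM; first exact: bicomm_scalar.
    apply: rpredM; last exact: bicomm_dyadic_res.
    exact: rpredX.
  have ppC : Bicomm pb * Bicomm pb = Bicomm pb :> bicomm_type a.
    by apply: bicomm_val_inj.
  have := @idem_corner_inverse (bicomm_type a) (Bicomm ab) (Bicomm pb) (Bicomm Hb) ppC.
  move=> /(congr1 (@bicomm_val _ _ a)) /= E; rewrite addrA -[X in X \is a _]E.
  rewrite unitrM_comm; first by case/andP.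
  apply: (@bicomm_comm _ _ a); first exact: rpredD.
  apply: rpredD => //; apply: rpredM => //.
  by rewrite rpredB ?rpred1.
have pc1 : GRing.comm p (a + p) by apply: commrD => //; exact: commr_sym.
have qc1 : GRing.comm (1 - p) (a + p).
  by apply: commr_sym; apply: commrB; [exact: commr1 | exact: commr_sym].
have aq : a * (1 - p) = (a + p) * (1 - p).
  by rewrite mulrDl [p * _]mulrBr mulr1 pp subrr addr0.
have pq : p * (1 - p) = 0 by rewrite mulrBr mulr1 pp subrr.
have qp0 : (1 - p) * p = 0 by rewrite mulrBl mul1r pp subrr.
exists ((a + p)^-1 * (1 - p)).
have dE : (a + p)^-1 * (1 - p) = (1 - p) * (a + p)^-1 by apply/commr_sym/commrV.
split.
- by rewrite dE mulrA aq -qc1 mulrK.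
- have -> : (a + p)^-1 * (1 - p) * a = (a + p)^-1 * (a * (1 - p)).
    rewrite -mulrA; congr (_ * _).
    by rewrite mulrBl mulrBr mul1r mulr1 ap.
  by rewrite aq mulKr.
- by rewrite -mulrA qp0 mulr0.
- by rewrite dE mulrA pq mul0r.
Qed.

End SpectralIdempotent.

(** * Isolated points and poles at 0 in terms of idempotents *)

Section SpectrumAtZero.
Variables (R : realType) (A : banachAlgType R[i]).
Implicit Types (a p x y : A).

Lemma comm_factor_unit x y : x * y = y * x -> x * y \is a GRing.unit -> x \is a GRing.unit.
Proof. by move=> xy; rewrite unitrM_comm // => /andP[]. Qed.

Lemma spectrum0E a : spectrum a 0 <-> a \isn't a GRing.unit.
Proof. by rewrite /spectrum /= scale0r sub0r unitrN. Qed.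

(** With [L = l - a] and [q = 1 - p], [L = (L p + q)(p + L q)] treats the two ranges separately: the
    first factor is invertible by quasinilpotency, the second for [|l|] below the inverse norm of
    [d]. *)
Lemma spectral_idem_isolated a p : spectral_idem a p ->
  exists2 delta : R, 0 < delta &
    forall l, 0 < cmod l < delta -> l%:A - a \is a GRing.unit.
Proof.
move=> [pp ap qp [d [ad da dp pd]]].
have d1 : 0 < rnorm d + 1 by rewrite ltr_wpDl ?rnorm_ge0.
exists (rnorm d + 1)^-1; first by rewrite invr_gt0.
move=> l /andP[l0 lr]; rewrite cmod_gt0 in l0.
have [q qE] : exists q, q = 1 - p by eexists.
rewrite -!qE in ad da.
have pq : p * q = 0 by rewrite qE mulrBr mulr1 pp subrr.
have qp0 : q * p = 0 by rewrite qE mulrBl mul1r pp subrr.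
have qq : q * q = q by rewrite {1}qE mulrBl mul1r pq subr0.
have qd : q * d = d by rewrite qE mulrBl mul1r pd subr0.
have dq : d * q = d by rewrite qE mulrBr mulr1 dp subr0.
have pDq : p + q = 1 by rewrite qE addrC subrK.
have [L LdE0] : exists L, L = l%:A - a by eexists.
have pL : p * L = L * p by rewrite LdE0 mulrBl mulrBr mulr_algl mulr_algr ap.
have qL : q * L = L * q by rewrite qE mulrBl mulrBr mul1r mulr1 pL.
have LdE : L * d = l *: d - q by rewrite LdE0 mulrBl mulr_algl ad.
have dLE : d * L = l *: d - q by rewrite LdE0 mulrBr mulr_algr da.
have t1 : L * p * (L * q) = 0 by rewrite -mulrA [p * _]mulrA pL -!mulrA pq !mulr0.
have t2 : q * (L * q) = L * q by rewrite mulrA qL -mulrA qq.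
have LE : L = (L * p + q) * (p + L * q).
  by rewrite mulrDl !mulrDr t1 t2 qp0 -mulrA pp addr0 add0r -mulrDr pDq mulr1.
have lu : 1 - l *: d \is a GRing.unit.
  apply: neumann; rewrite rnormZ.
  have : cmod l * (rnorm d + 1) < 1 by rewrite -ltr_pdivlMr // div1r.
  by apply: le_lt_trans; rewrite ler_wpM2l ?cmod_ge0 // lerDl.
have E0 : p - (l *: d - q) = 1 - l *: d by rewrite opprB addrA pDq.
(* [p - d] inverts [p + L q] at [l = 0]; for small [l] the product is a Neumann unit on either
   side. *)
have E2 : (p + L * q) * (p - d) = 1 - l *: d.
  by rewrite mulrDl !mulrBr pp pd subr0 -!mulrA qp0 qd mulr0 sub0r LdE E0.
have E3 : (p - d) * (p + L * q) = 1 - l *: d.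
  rewrite mulrBl !mulrDr pp dp add0r [p * _]mulrA pL -[L * p * q]mulrA pq mulr0 addr0.
  by rewrite mulrA dLE mulrBl qq -scalerAl dq E0.
have u2 : p + L * q \is a GRing.unit.
  by apply: (@comm_factor_unit _ (p - d)); rewrite E2 ?E3.
rewrite -LdE0 LE unitrMr //.
have u1 := qnil_unit (qnil_mul_idem ap pp qp) l0.
have -> : L * p + q = (l%:A - a * p) * (p + l^-1 *: q).
  rewrite LdE0 !mulrBl !mulr_algl scalerDr scalerA mulfV // scale1r mulrDr -!scalerAr.
  by rewrite -!mulrA pp pq mulr0 scaler0 addr0 addrAC.
rewrite unitrMr //; apply/unitrP; exists (p + l *: q).
split.
all: rewrite mulrDl !mulrDr -!scalerAl -!scalerAr pp pq qp0 qq !scaler0 addr0 add0r.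
all: by rewrite scalerA ?mulfV ?mulVf // scale1r pDq.
Qed.

Lemma spectral_idem_unit a p : spectral_idem a p -> a \is a GRing.unit <-> p = 0.
Proof.
move=> [pp ap qp [d [ad da dp pd]]]; split=> [au|p0]; last first.
  by apply/unitrP; exists d; rewrite ad da p0 subr0.
apply: rnorm_eq0_small => e e0.
have K0 : 0 < rnorm a^-1 * 1 + 1 by rewrite ltr_wpDl // mulr1 rnorm_ge0.
have N0 : 0 < e / rnorm (1 : A) by rewrite divr_gt0 // (lt_le_trans ltr01 (rnorm1_ge1 A)).
have [n /(_ n (leqnn _))] := qnil_small qp K0 N0.
rewrite ltr_pdivlMr ?(lt_le_trans ltr01 (rnorm1_ge1 A)) // => /ltW; apply: le_trans.
have -> : p = a^-1 ^+ n * (a ^+ n * p) by rewrite mulrA exprVn mulVr ?mul1r // unitrX.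
have -> : a ^+ n * (a^-1 ^+ n * (a ^+ n * p)) = a ^+ n * p.
  by rewrite exprVn mulVKr // unitrX.
rewrite (le_trans (rnormM _ _))// mulrAC ler_wpM2r ?rnorm_ge0 //.
rewrite (le_trans (rnormX _ _))// ler_wpM2r ?rnorm_ge0 // lerXn2r ?nnegrE ?rnorm_ge0 //.
  exact: ltW.
by rewrite mulr1 lerDl.
Qed.

Lemma isolated0_spectral_idem a : isolated (spectrum a) 0 <->
  exists2 p, p != 0 & spectral_idem a p.
Proof.
rewrite isolated0P; split=> [[/spectrum0E a0 [_ /posc_ex[r r0 ->] H]]|[p p0 ap]].
  have [|p ap] := @isolated_spectral_idem _ _ a r r0.
    move=> l hl; have /negP : ~ spectrum a l by apply: H; rewrite cmodE !ltcR.
    by rewrite negbK.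
  exists p => //; apply: contraNneq a0 => p0.
  exact/(spectral_idem_unit ap).
split.
  by apply/spectrum0E/negP => /(spectral_idem_unit ap) p0'; rewrite p0' eqxx in p0.
have [r r0 H] := spectral_idem_isolated ap.
exists r%:C%C; first by rewrite ltcR.
by move=> l; rewrite cmodE !ltcR => /H lu /negP; rewrite lu.
Qed.

(* The spectral idempotent of [c] absorbs every [f] on which [c] is
   quasinilpotent. *)
Lemma spectral_idem_absorb (c e f : A) n : spectral_idem c e -> c ^+ n * e = 0 ->
  qnil c f -> c ^+ n * f = 0.
Proof.
move=> ce cne qf; suff fE : f = e * f by rewrite fE mulrA cne mul0r.
apply/eqP; rewrite -subr_eq0 -{1}[f]mul1r -mulrBl; apply/eqP.
apply: rnorm_eq0_small => r r0.
have [_ _ _ [d [_ dc de _]]] := ce.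
have K0 : 0 < rnorm d + 1 by rewrite ltr_wpDl ?rnorm_ge0.
have N0 : 0 < r / rnorm (1 : A) by rewrite divr_gt0 // (lt_le_trans ltr01 (rnorm1_ge1 A)).
have [m /(_ m.+1 (leqnSn _))] := qnil_small qf K0 N0.
rewrite ltr_pdivlMr ?(lt_le_trans ltr01 (rnorm1_ge1 A)) // => /ltW; apply: le_trans.
(* So [(1 - e) f = d^(m+1) c^(m+1) f], and quasinilpotency of [c] on [f] beats the growth of
   [d^(m+1)]. *)
have -> : 1 - e = d ^+ m.+1 * c ^+ m.+1.
  elim: m => [|m IH]; first by rewrite !expr1.
  by rewrite [d ^+ _]exprS [c ^+ _]exprSr mulrA -[d * _ * _]mulrA -IH mulrBr mulr1 de subr0.
rewrite -mulrA (le_trans (rnormM _ _))// mulrAC ler_wpM2r ?rnorm_ge0 //.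
rewrite (le_trans (rnormX _ _))// ler_wpM2r ?rnorm_ge0 // lerXn2r ?nnegrE ?rnorm_ge0 ?(ltW K0) //.
by rewrite lerDl.
Qed.

Lemma spectral_idem_pole a p n : spectral_idem a p -> p != 0 -> a ^+ n * p = 0 ->
  poles a 0.
Proof.
move=> ap p0 anp; split; first by apply/isolated0_spectral_idem; exists p.
have ex : exists n, a ^+ n * p == 0 by exists n; rewrite anp.
(* The pole order is the least exponent killing [p]; minimality makes the leading coefficient
   [a^m p] nonzero. *)
case: (ex_minnP ex) => -[|m] /eqP mP mmin.
  by rewrite expr0 mul1r in mP; rewrite mP eqxx in p0.
exists m.+1 => //; have [r0 r00 Hr0] := spectral_idem_isolated ap.
have [pp cap qp [d [ad da dp pd]]] := ap.
(* The regular part inverts [l - a] on the range of [1 - p] and sums to [- d (1 - l d)^-1]; the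
   principal part is the finite series of [(l - a)^-1] on the range of [p]. *)
exists (fun k => - d ^+ k.+1), (fun k => a ^+ k.-1 * p); split; last 2 first.
- by apply/negP => /mmin; rewrite ltnn.
- move=> k mk; have -> : k.-1 = ((k.-1 - m.+1) + m.+1)%N.
    by rewrite subnK //; case: k mk.
  by rewrite exprD -mulrA mP mulr0.
have d1 : 0 < rnorm d + 1 by rewrite ltr_wpDl ?rnorm_ge0.
exists (Num.min r0 (rnorm d + 1)^-1)%:C%C; first by rewrite ltcR lt_min r00 invr_gt0.
move=> l; rewrite subr0 cmodE !ltcR => /andP[l0]; rewrite lt_min => /andP[lr ld].
have lu : l%:A - a \is a GRing.unit by apply: Hr0; rewrite l0.
have l0' : l != 0 by rewrite -cmod_gt0.
have q1 : cmod l * rnorm d < 1.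
  have : cmod l * (rnorm d + 1) < 1 by rewrite -ltr_pdivlMr // div1r.
  by apply: le_lt_trans; rewrite ler_wpM2l ?cmod_ge0 // lerDl.
have zu : 1 - l *: d \is a GRing.unit by apply: neumann; rewrite rnormZ.
set z := (1 - l *: d)^-1.
have zE : z - 1 = l *: (d * z).
  by rewrite -[X in _ - X](mulrV zu) -/z mulrBl mul1r subKr scalerAl.
have pz : p * z = p.
  by apply: (mulIr zu); rewrite /z mulrVK // mulrBr mulr1 -scalerAr pd scaler0 subr0.
pose s : A := - (d * z).
pose t : A := \sum_(1 <= k < m.+2) l ^- k *: (a ^+ k.-1 * p).
have sumE N : \sum_(0 <= k < N) l ^+ k *: - d ^+ k.+1 - s = l ^+ N *: (d ^+ N.+1 * z).
  rewrite /s opprK; elim: N => [|N IH].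
    by rewrite big_geq // add0r expr0 scale1r expr1.
  rewrite big_nat_recr //= addrAC IH scalerN -scalerBr -[X in _ - X]mulr1 -mulrBr zE.
  by rewrite -scalerAr scalerA -exprSr mulrA -exprSr.
have c1 : rcvg (fun N => \sum_(0 <= k < N) l ^+ k *: - d ^+ k.+1) s.
  apply: (@rcvg_le _ _ (rnorm d * rnorm (1 : A) * rnorm z) (cmod l * rnorm d)).
    by rewrite q1 mulr_ge0 ?cmod_ge0 ?rnorm_ge0.
  move=> N; rewrite sumE rnormZ cmodX exprMn [leRHS]mulrCA ler_wpM2l ?exprn_ge0 ?cmod_ge0 //.
  rewrite (le_trans (rnormM _ _))// [leRHS]mulrAC ler_wpM2r ?rnorm_ge0 //.
  by rewrite mulrAC -exprS rnormX.
have c2 : rcvg (fun N => \sum_(1 <= k < N) l ^- k *: (a ^+ k.-1 * p)) t.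
  move=> e e0; exists m.+2 => N mN.
  rewrite /t (@big_cat_nat _ _ _ m.+2 1 N) //= addrAC subrr add0r big_nat big1 ?rnorm0 // => k.
  move=> /andP[mk _]; have -> : k.-1 = ((k.-1 - m.+1) + m.+1)%N.
    by rewrite subnK //; case: k mk.
  by rewrite exprD -mulrA mP mulr0 scaler0.
exists (s : normed_space A), (t : normed_space A); split.
- exact/rcvgP.
- exact/rcvgP.
apply: (mulrI lu); rewrite mulrV // mulrDr.
have -> : (l%:A - a) * s = 1 - p.
  have dzl : l *: (d * z) = z - 1 by rewrite zE.
  rewrite /s mulrN mulrBl mulr_algl dzl mulrA ad mulrBl mul1r pz.
  by rewrite opprB opprB addrC addrA subrK.
have -> : (l%:A - a) * t = p.
  have lk k : l * l ^- k.+1 = l ^- k by rewrite exprS invfM mulrA mulfV // mul1r.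
  have T j : (l%:A - a) * (\sum_(1 <= k < j.+1) l ^- k *: (a ^+ k.-1 * p)) =
      p - l ^- j *: (a ^+ j * p).
    elim: j => [|j IH]; first by rewrite big_geq // mulr0 expr0 invr1 scale1r mul1r subrr.
    rewrite big_nat_recr //= mulrDr IH mulrBl mulr_algl scalerA lk -scalerAr mulrA -exprS.
    by rewrite addrA subrK.
  by rewrite T mP scaler0 subr0.
by rewrite subrK.
Qed.

End SpectrumAtZero.

(** * Cauchy estimates: a pole makes the singular part nilpotent *)

Section PoleAtZero.
Variables (R : realType) (A : banachAlgType R[i]).
Implicit Types (a p x y : A).

Lemma rcvg_bounded (u : nat -> A) x : rcvg u x -> exists B : R, forall n, rnorm (u n) <= B.
Proof.
move=> /(_ 1 ltr01)[n0 H].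
exists (\sum_(i < n0) rnorm (u i) + (1 + rnorm x)) => n.
have S0 : 0 <= \sum_(i < n0) rnorm (u i) by rewrite sumr_ge0 // => i _; exact: rnorm_ge0.
have [nn|nn] := ltnP n n0.
  rewrite (bigD1 (Ordinal nn)) //= -addrA lerDl addr_ge0 ?addr_ge0 ?rnorm_ge0 //.
  by rewrite sumr_ge0 // => i _; exact: rnorm_ge0.
rewrite -[u n](subrK x) (le_trans (rnormD _ _))// ler_wpDl // lerD // ltW //.
exact: H.
Qed.

Lemma pole_resolvent_bound a : poles a 0 ->
  exists (m : nat) (r C : R), 0 < r /\
    forall l, 0 < cmod l < r -> rnorm (resolvent a l) <= C * (cmod l) ^- m.
Proof.
move=> [_ [m m1 [u [b [[r0 /posc_ex[r r00 ->] L] bm b0]]]]].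
pose l0 : R[i] := (r / 2)%:C%C.
have r2 : 0 < r / 2 by rewrite divr_gt0.
have cl0 : cmod l0 = r / 2 by rewrite cmodR ger0_norm // ltW.
(* Terms of a convergent series are bounded. Halving the radius once more gives the regular part a
   geometric majorant of ratio 1/2. *)
have [B HB] : exists B : R, forall n, rnorm (u n) * (r / 2) ^+ n <= B.
  have [|s [_ [/rcvgP hs _ _]]] := L l0.
    by rewrite subr0 cmodE !ltcR cl0 r2 ltr_pdivrMr // mulr_natr mulr2n ltrDl.
  have [B HB] := rcvg_bounded hs; exists (B + B) => n.
  rewrite mulrC -cl0 -cmodX -rnormZ -[l0]subr0.
  apply: le_trans (_ : rnorm (\sum_(0 <= k < n.+1) (l0 - 0) ^+ k *: u k -
    \sum_(0 <= k < n) (l0 - 0) ^+ k *: u k) <= _); last first.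
    by rewrite (le_trans (rnormB _ _))// lerD // HB.
  by rewrite big_nat_recr //= [X in _ <= rnorm X]addrC addKr.
have B0 : 0 <= B by rewrite (le_trans _ (HB 0%N)) // mulr_ge0 ?rnorm_ge0 ?exprn_ge0 // ltW.
pose K : R := \sum_(1 <= k < m.+1) rnorm (b k).
have K0 : 0 <= K by rewrite sumr_ge0 // => i _; exact: rnorm_ge0.
exists m, (Num.min 1 (r / 2 / 2)), (2 * B + K).
have r4 : 0 < r / 2 / 2 by rewrite divr_gt0.
split; first by rewrite lt_min ltr01 r4.
move=> l; rewrite lt_min => /and3P[l00 l1 lr].
have l0n : l != 0 by rewrite -cmod_gt0.
have [|s [t [/rcvgP hs /rcvgP ht ->]]] := L l.
  by rewrite subr0 cmodE !ltcR l00; lra.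
have lm : 1 <= cmod l ^- m by rewrite invf_ge1 ?exprn_gt0 // exprn_ile1 // ltW.
have sB : rnorm (s : A) <= 2 * B.
  apply: (rcvg_norm_le hs (n0 := 0)) => n _.
  apply: (le_trans (rnorm_sum _ _)).
  have q2 k : rnorm ((l - 0) ^+ k *: u k) <= B * 2^-1 ^+ k.
    rewrite subr0 rnormZ cmodX mulrC; apply: le_trans (_ : rnorm (u k) * (r / 2 / 2) ^+ k <= _).
      by rewrite ler_wpM2l ?rnorm_ge0 // lerXn2r ?nnegrE ?cmod_ge0 ?ltW.
    by rewrite exprMn mulrA ler_wpM2r ?exprn_ge0.
  apply: (le_trans (ler_sum_nat (fun k _ => q2 k))).
  have -> : \sum_(0 <= k < n) B * 2^-1 ^+ k = 2 * B * (1 - 2^-1 ^+ n) :> R.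
    elim: (n) => [|j IH]; first by rewrite big_geq // expr0 subrr mulr0.
    by rewrite big_nat_recr //= IH exprS; field.
  by rewrite ler_piMr ?mulr_ge0 // gerBl exprn_ge0 // invr_ge0.
have tK : rnorm (t : A) <= K * cmod l ^- m.
  apply: (rcvg_norm_le ht (n0 := m.+1)) => n mn.
  rewrite (@big_cat_nat _ _ _ m.+1 1 n) //= [X in _ + X]big_nat [X in _ + X]big1; last first.
    by move=> k /andP[mk _]; rewrite b0 // scaler0.
  rewrite addr0 /K big_distrl /= !big_add1 (le_trans (rnorm_sum _ _))//.
  apply: ler_sum_nat => k km; rewrite subr0 rnormZ cmodV cmodX mulrC.
  rewrite ler_wpM2l ?rnorm_ge0 // lef_pV2 ?posrE ?exprn_gt0 //.
  by apply: ler_wiXn2l; rewrite ?ltW.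
rewrite (le_trans (rnormD _ _))// mulrDl lerD //.
by rewrite (le_trans sB) // ler_peMr // mulr_ge0.
Qed.

(** Discrete Cauchy integrals. In the second bound the difference identity starts the induction;
    afterwards rotating [w] changes [(w a)^(2^k)] only by a unimodular scalar, so averaging
    preserves the bound. *)
Lemma dyadic_res_circle a (r B : R) :
  (forall w, cmod w = r -> 1 - w *: a \is a GRing.unit) ->
  (forall w, cmod w = r -> rnorm (1 - w *: a)^-1 <= B) ->
  (forall k w, cmod w = r -> rnorm (dyadic_res a w k) <= B) /\
  (forall k j w, cmod w = r ->
    rnorm ((w *: a) ^+ (2 ^ k) * dyadic_res a w (k + j).+1) <= B).
Proof.
move=> au aB.
have au' w w' : cmod w = r -> cmod w' = cmod w -> 1 - w' *: a \is a GRing.unit.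
  by move=> wr w'w; apply: au; rewrite w'w.
have c2 : cmod (2 : R[i]) = 2 by rewrite -[2]/(2%:R) -(rmorph_nat (real_complex R)) cmodR ger0_norm.
have half x y z : rnorm x <= B -> rnorm y <= B -> x + y = 2 *: z -> rnorm z <= B.
  move=> hx hy E; have := rnormD x y; rewrite E rnormZ c2; lra.
have root k : exists2 z : R[i], z ^+ (2 ^ k) = -1 & cmod z = 1.
  by have [z zE] := dyadic_root R k; exists z => //; exact: dyadic_root_cmod zE.
have rot w z : cmod z = 1 -> cmod w = r -> cmod (z * w) = r.
  by move=> z1 wr; rewrite cmodM z1 mul1r.
have D k w : cmod w = r -> rnorm (dyadic_res a w k) <= B.
  elim: k w => [|k IH] w wr; first by rewrite /dyadic_res expr1 aB.
  have [z zE z1] := root k; have [E _] := dyadic_res_double zE (au' w ^~ wr).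
  by apply: half E; apply: IH => //; exact: rot.
split=> // k j; elim: j => [|j IH] w wr.
  rewrite addn0; have [z zE z1] := root k; have [_ E] := dyadic_res_double zE (au' w ^~ wr).
  by apply: half E; rewrite ?rnormN; apply: D => //; exact: rot.
rewrite addnS; have [z zE z1] := root (k + j).+1.
have [E _] := dyadic_res_double zE (au' w ^~ wr).
apply: half (_ : _ + _ = 2 *: ((w *: a) ^+ (2 ^ k) * dyadic_res a w (k + j).+2)).
- exact: IH wr.
- have := IH (z * w) (rot _ _ z1 wr).
  by rewrite -scalerA exprZn -scalerAl rnormZ cmodX z1 expr1n mul1r; apply.
- by rewrite -mulrDr E scalerAr.
Qed.

(** Insert [1 = P_K (1 - (w a)^(2^K))] between [(w a)^(2^k)] and [p]: the first term is bounded by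
    the discrete Cauchy integral, and the second tends to 0 in [K] because [a] is quasinilpotent on
    [p]. *)
Lemma cauchy_estimate a p (r B : R) k : qnil a p -> 0 < r ->
  (forall w, cmod w = r -> 1 - w *: a \is a GRing.unit) ->
  (forall w, cmod w = r -> rnorm (1 - w *: a)^-1 <= B) ->
  r ^+ (2 ^ k) * rnorm (a ^+ (2 ^ k) * p) <= B * rnorm p.
Proof.
move=> qp r0 au aB; pose w : R[i] := r%:C%C.
have wr : cmod w = r by rewrite cmodR ger0_norm // ltW.
have B0 : 0 <= B := le_trans (rnorm_ge0 _) (aB w wr).
have B1 : 0 < B + 1 by rewrite ltr_wpDl.
rewrite -{1}wr -cmodX -rnormZ scalerAl -exprZn.
have [_ D] := dyadic_res_circle au aB; apply: le_small => e e0.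
have [n0 Hn] := qnil_small qp r0 (divr_gt0 e0 B1).
pose K := (k + n0).+1.
have u : 1 - (w *: a) ^+ (2 ^ K) \is a GRing.unit.
  by apply: dyadic_unit => w' w'r; apply: au; rewrite w'r.
have -> : (w *: a) ^+ (2 ^ k) * p = (w *: a) ^+ (2 ^ k) * dyadic_res a w K * p
    - (w *: a) ^+ (2 ^ k) * dyadic_res a w K * ((w *: a) ^+ (2 ^ K) * p).
  rewrite -mulrBr; have -> : p - (w *: a) ^+ (2 ^ K) * p = (1 - (w *: a) ^+ (2 ^ K)) * p.
    by rewrite mulrBl mul1r.
  by rewrite mulrA mulrVK.
apply: (le_trans (rnormB _ _)); apply: lerD.
  by rewrite (le_trans (rnormM _ _))// ler_wpM2r ?rnorm_ge0 // D.
have := Hn (2 ^ K)%N; rewrite ltr_pdivlMr // => h.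
have wp : rnorm ((w *: a) ^+ (2 ^ K) * p) = r ^+ (2 ^ K) * rnorm (a ^+ (2 ^ K) * p).
  by rewrite exprZn -scalerAl rnormZ cmodX wr.
apply: (le_trans (rnormM _ _)); rewrite wp.
apply: (@le_trans _ _ ((B + 1) * (r ^+ (2 ^ K) * rnorm (a ^+ (2 ^ K) * p)))).
  rewrite ler_wpM2r ?mulr_ge0 ?exprn_ge0 ?rnorm_ge0 ?(ltW r0) //.
  by rewrite (le_trans (D _ _ _ wr)) // lerDl.
rewrite mulrC; apply/ltW/h; apply: leq_trans (ltnW (ltn_expl _ (ltnSn 1))).
by rewrite /K leqW // leq_addl.
Qed.

Lemma pole_spectral_idem a : poles a 0 ->
  exists p n, [/\ p != 0, spectral_idem a p & a ^+ n * p = 0].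
Proof.
move=> a0; have [/isolated0_spectral_idem[p p0 ap] _] := a0.
have [m [r [C [r0 HC]]]] := pole_resolvent_bound a0.
have [d d0 Hd] := spectral_idem_isolated ap.
(* Only exponents that are powers of two are estimated. On radius [s] the resolvent contributes at
   most [|C| s^m], and [2^m >= m + 1] leaves a spare factor [s]; letting [s] grow gives 0. *)
exists p, (2 ^ m)%N; split=> //.
have [pp _ qp _] := ap.
pose Z := 1 + r^-1 + d^-1.
have Z0 : 0 < Z by rewrite /Z !addr_gt0 // invr_gt0.
have est s : Z < s -> s * rnorm (a ^+ (2 ^ m) * p) <= `|C| * rnorm p.
  move=> Zs; have s0 : 0 < s := lt_trans Z0 Zs.
  have ri := invr_ge0 r; have di := invr_ge0 d.
  have s1 : 1 < s by move: Zs; rewrite /Z; rewrite (ltW r0) in ri; rewrite (ltW d0) in di; lra.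
  have sr : s^-1 < r.
    rewrite -[r]invrK ltf_pV2 ?posrE ?invr_gt0 //.
    by move: Zs; rewrite /Z; rewrite (ltW r0) in ri; rewrite (ltW d0) in di; lra.
  have sd : s^-1 < d.
    rewrite -[d]invrK ltf_pV2 ?posrE ?invr_gt0 //.
    by move: Zs; rewrite /Z; rewrite (ltW r0) in ri; rewrite (ltW d0) in di; lra.
  have wl w : cmod w = s -> [/\ w != 0, cmod w^-1 = s^-1 & 1 - w *: a \is a GRing.unit].
    move=> ws; have w0 : w != 0 by rewrite -cmod_gt0 ws.
    split=> //; first by rewrite cmodV ws.
    by rewrite -[w]invrK -scalar_sub_unit ?invr_eq0 // Hd // cmodV ws invr_gt0 s0.
  have au w : cmod w = s -> 1 - w *: a \is a GRing.unit by case/wl.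
  have aB w : cmod w = s -> rnorm (1 - w *: a)^-1 <= `|C| * s ^+ m.
    move=> ws; have [w0 cw wu] := wl w ws.
    have -> : (1 - w *: a)^-1 = w^-1 *: resolvent a w^-1.
      have lu : (w^-1)%:A - a \is a GRing.unit by rewrite scalar_sub_unit ?invr_eq0 // invrK.
      apply: (mulrI wu); rewrite mulrV // -scalerAr scalerAl.
      have -> : w^-1 *: (1 - w *: a) = (w^-1)%:A - a.
        by rewrite scalerBr scalerA mulVf // scale1r.
      by rewrite mulrV.
    rewrite rnormZ cw; apply: le_trans (_ : 1 * (C * cmod w^-1 ^- m) <= _).
      apply: ler_pM; rewrite ?rnorm_ge0 ?invr_ge0 ?(ltW s0) //.
        by rewrite invf_le1 // ltW.
      by apply: HC; rewrite cw invr_gt0 s0.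
    rewrite mul1r cw exprVn invrK ler_wpM2r ?exprn_ge0 ?(ltW s0) //; exact: ler_norm.
  have sm : s ^+ m.+1 <= s ^+ (2 ^ m) by rewrite ler_weXn2l ?(ltW s1) // ltn_expl.
  have h := cauchy_estimate m qp s0 au aB; have sm0 : 0 < s ^+ m by rewrite exprn_gt0.
  rewrite -(ler_pM2l sm0) mulrA -exprSr [leRHS]mulrA [_ * `|C|]mulrC; apply: le_trans h.
  by rewrite ler_wpM2r ?rnorm_ge0.
apply: rnorm0_eq0; apply/eqP; rewrite eq_le rnorm_ge0 andbT leNgt; apply/negP => x0.
have c0 : 0 <= `|C| * rnorm p / rnorm (a ^+ (2 ^ m) * p).
  by rewrite !mulr_ge0 ?invr_ge0 ?rnorm_ge0.
have := est (Z + 1 + `|C| * rnorm p / rnorm (a ^+ (2 ^ m) * p)).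
have -> : Z < Z + 1 + `|C| * rnorm p / rnorm (a ^+ (2 ^ m) * p) by lra.
move=> /(_ isT); rewrite mulrDl mulfVK ?gt_eqF //; have := mulr_gt0 Z0 x0; lra.
Qed.

End PoleAtZero.

(** * Poles, essential singularities, nilpotent and quasinilpotent elements *)

Section PolesAtZero.
Variables (R : realType) (A : banachAlgType R[i]).
Implicit Types (a p x y : A).

Lemma poles0P a : poles a 0 <->
  exists p n, [/\ p != 0, spectral_idem a p & a ^+ n * p = 0].
Proof.
split; first exact: pole_spectral_idem.
by move=> [p [n [p0 ap anp]]]; exact: spectral_idem_pole ap p0 anp.
Qed.

Lemma nonpoles0P a : nonpoles a 0 <->
  exists p, [/\ p != 0, spectral_idem a p & forall n, a ^+ n * p <> 0].
Proof.
split=> [[/isolated0_spectral_idem[p p0 ap] npa]|[p [p0 ap anp]]].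
  by exists p; split=> // n anp; apply/npa/poles0P; exists p, n.
split; first by apply/isolated0_spectral_idem; exists p.
move=> /poles0P[q [n [q0 aq anq]]]; apply: (anp n).
by apply: (spectral_idem_absorb aq anq); case: ap.
Qed.

Lemma qnil1_spectral_idem a : qnil a 1 -> spectral_idem a 1.
Proof.
move=> qa; split; rewrite ?mulr1 //; first exact: commr1.
by exists 0; rewrite subrr mulr0 !mul0r mulr0.
Qed.

Lemma qnil_spectrum a : qnil a 1 <-> spectrum a = [set 0].
Proof.
split=> [qa|sa].
  apply/seteqP; split=> [l /= al|_ ->].
    by apply/eqP; apply: contraNT al; exact: qnil_unit.
  apply/spectrum0E/negP => /(spectral_idem_unit (qnil1_spectral_idem qa)) /eqP.
  by rewrite oner_eq0.
apply: spectrum_sub0_qnil => l l0; apply: contraT => al.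
have : spectrum a l by [].
by rewrite sa => l0'; rewrite l0' eqxx in l0.
Qed.

Lemma unit_spectral_idem a : a \is a GRing.unit -> spectral_idem a 0.
Proof.
move=> au; split; rewrite ?mulr0 //; first exact: commr0.
  by move=> rho _; exists 0 => n; rewrite mulr0 rnorm0 mul0r.
by exists a^-1; rewrite subr0 mulrV // mulVr // mulr0 mul0r.
Qed.

Lemma nilpotent_qnil a : nilpotent_elt a -> qnil a 1.
Proof.
move=> [m am] rho r0; have [||C HC] := @pow_bound _ _ a rho m.+1 r0; first by [].
  by rewrite exprS am mulr0 rnorm0 exprn_ge0 // ltW.
by exists C => n; rewrite mulr1.
Qed.

Lemma poles_sub_spectrum a : poles a `<=` spectrum a.
Proof. by move=> l [[/set_mem]]. Qed.

(** Turns (i) into a statement on nilpotency: [a] is quasinilpotent on 1, so absorption replaces the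
    idempotent of the pole by 1. *)
Lemma nilpotentP a : spectrum a = [set 0] /\ poles a = [set 0] <-> nilpotent_elt a.
Proof.
split=> [[sa pa]|na].
  have /poles0P[p [n [_ ap anp]]] : poles a 0 by rewrite pa.
  exists n; rewrite -[LHS]mulr1; apply: (spectral_idem_absorb ap anp).
  exact/qnil_spectrum.
have qa := nilpotent_qnil na; have /qnil_spectrum sa := qa; split=> //.
apply/seteqP; split=> [l|_ ->]; first by rewrite -sa; exact: poles_sub_spectrum.
case: na => n an; apply/poles0P; exists 1, n.
by rewrite oner_neq0 mulr1; split=> //; exact: qnil1_spectral_idem.
Qed.

Lemma qnil_nonpolesP a : ~ nilpotent_elt a ->
  spectrum a = [set 0] /\ nonpoles a = [set 0] <-> qnil a 1.
Proof.
move=> na; split=> [[/qnil_spectrum//]|qa]; have /qnil_spectrum sa := qa.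
split=> //; apply/seteqP; split=> [l [[/set_mem]]|_ ->]; first by rewrite sa.
apply/nonpoles0P; exists 1; rewrite oner_neq0; split=> //.
  exact: qnil1_spectral_idem.
by move=> n; rewrite mulr1 => an; apply: na; exists n.
Qed.

Lemma spectrum_pow_le a (l : R[i]) n : l%:A - a \isn't a GRing.unit ->
  cmod l ^+ n <= rnorm (a ^+ n).
Proof.
have [-> _|l0 au] := eqVneq l 0.
  case: n => [|n]; first by rewrite !expr0 rnorm1_ge1.
  by rewrite cmod0 expr0n rnorm_ge0.
rewrite leNgt; apply: contra au => h; rewrite scalar_sub_unit //.
apply: (@unit_1subX _ _ _ n); apply: neumann; rewrite exprZn rnormZ cmodX cmodV exprVn.
by rewrite mulrC ltr_pdivrMr ?mul1r // exprn_gt0 // cmod_gt0.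
Qed.

End PolesAtZero.

(** * Tensor products *)

Section Tensor.
Variable R : realType.

(** Statements (i) to (vi) use the completed tensor product only through these rules. They are
    symmetric in the two factors, so one half of each statement suffices. *)
Record crossed (A B T : banachAlgType R[i]) (ot : A -> B -> T) : Prop := Crossed {
  crossedBl : forall x x' y, ot (x - x') y = ot x y - ot x' y;
  crossedBr : forall x y y', ot x (y - y') = ot x y - ot x y';
  crossedZ : forall l m x y, ot (l *: x) (m *: y) = (l * m) *: ot x y;
  crossedM : forall x x' y y', ot x y * ot x' y' = ot (x * x') (y * y');
  crossed1 : ot 1 1 = 1;
  crossed_norm : forall x y, rnorm (ot x y) = rnorm x * rnorm y }.

Lemma crossed_flip (A B T : banachAlgType R[i]) (ot : A -> B -> T) :
  crossed ot -> crossed (fun y x => ot x y).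
Proof.
move=> [? ? Z ? ? N]; split=> // [l m y x|y x]; first by rewrite Z [m * l]mulrC.
by rewrite N mulrC.
Qed.

Lemma qnil_mul_le (A B : banachAlgType R[i]) (a p : A) (b y : B) (rho : R) : qnil a p -> 0 < rho ->
  exists C : R, forall n, rnorm (a ^+ n * p) * rnorm (b ^+ n * y) <= C * rho ^+ n.
Proof.
move=> qa r0; have b1 : 0 < rnorm b + 1 by rewrite ltr_wpDl ?rnorm_ge0.
have [C HC] := qa _ (divr_gt0 r0 b1).
exists (C * (rnorm (1 : B) * rnorm y)) => n.
have -> : rho = rho / (rnorm b + 1) * (rnorm b + 1) by rewrite mulfVK ?gt_eqF.
rewrite exprMn mulrACA ler_pM ?rnorm_ge0 // (le_trans (rnormM _ _))//.
rewrite mulrAC ler_wpM2r ?rnorm_ge0 // (le_trans (rnormX _ _))// mulrC.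
rewrite ler_wpM2l ?rnorm_ge0 // lerXn2r ?nnegrE ?rnorm_ge0 ?(ltW b1) //.
by rewrite lerDl.
Qed.

Section OneSide.
Variables (A B T : banachAlgType R[i]) (ot : A -> B -> T).
Hypothesis H : crossed ot.
Implicit Types (a p x : A) (b q y : B).

Lemma crossedX x y n : ot x y ^+ n = ot (x ^+ n) (y ^+ n).
Proof.
elim: n => [|n IH]; first by rewrite !expr0 (crossed1 H).
by rewrite !exprS IH (crossedM H).
Qed.

Lemma crossed_eq0 x y : ot x y = 0 <-> x = 0 \/ y = 0.
Proof.
split=> [xy0|xy0].
  have /eqP : rnorm x * rnorm y = 0 by rewrite -(crossed_norm H) xy0 rnorm0.
  by rewrite mulf_eq0 => /orP[]/eqP/rnorm0_eq0; [left|right].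
apply: rnorm0_eq0; rewrite (crossed_norm H).
by case: xy0 => ->; rewrite rnorm0 ?mul0r ?mulr0.
Qed.

Lemma nilpotent_crossed a b :
  nilpotent_elt (ot a b) <-> nilpotent_elt a \/ nilpotent_elt b.
Proof.
split=> [[n]|[|]].
- by rewrite crossedX => /crossed_eq0[]; [left|right]; exists n.
- by move=> [n an]; exists n; rewrite crossedX; apply/crossed_eq0; left.
- by move=> [n bn]; exists n; rewrite crossedX; apply/crossed_eq0; right.
Qed.

Lemma qnil_crossedl a b : qnil a 1 -> qnil (ot a b) 1.
Proof.
move=> qa rho r0; have [C HC] := qnil_mul_le b 1 qa r0; exists C => n.
by have := HC n; rewrite !mulr1 crossedX (crossed_norm H).
Qed.

(** Otherwise nonzero spectral points [l] and [m] exist, and the norm of [(a (x) b)^n] is at least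
    [|l m|^n], contradicting the root test. *)
Lemma crossed_qnil a b : qnil (ot a b) 1 -> qnil a 1 \/ qnil b 1.
Proof.
move=> qc; apply: contrapT => /not_orP[na nb].
have nonzero (D : banachAlgType R[i]) (x : D) : ~ qnil x 1 ->
    exists2 l, l != 0 & l%:A - x \isn't a GRing.unit.
  move=> nx; apply: contrapT => h; apply: nx; apply: spectrum_sub0_qnil => l l0.
  by apply: contraT => lx; exfalso; apply: h; exists l.
have [l l0 la] := nonzero _ _ na; have [m m0 mb] := nonzero _ _ nb.
have lm : 0 < cmod l * cmod m by rewrite mulr_gt0 ?cmod_gt0.
have lmi : 0 < (cmod l * cmod m)^-1 by rewrite invr_gt0.
have [n /(_ n (leqnn _))] := qnil_small qc lmi ltr01.
apply/negP; rewrite -leNgt mulr1 crossedX (crossed_norm H) exprVn mulrC.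
rewrite ler_pdivlMr ?exprn_gt0 // mul1r exprMn.
by rewrite ler_pM ?exprn_ge0 ?cmod_ge0 // spectrum_pow_le.
Qed.

(** The idempotent splits as [p (x) 1 + (1 - p) (x) q]; in each summand one factor is quasinilpotent
    and the other grows at most exponentially. The inverse on the complement is [d (x) d']. *)
Lemma crossed_spectral_idem a b p q : spectral_idem a p -> spectral_idem b q ->
  spectral_idem (ot a b) (1 - ot (1 - p) (1 - q)).
Proof.
move=> [pp ap qp [d [ad da dp pd]]] [qq bq qb [d' [bd db dq qd]]].
have idem (D : pzRingType) (x : D) : x * x = x -> (1 - x) * (1 - x) = 1 - x.
  by move=> xx; rewrite mulrBl mul1r mulrBr mulr1 xx subrr subr0.
set f := ot (1 - p) (1 - q).
have ff : f * f = f by rewrite (crossedM H) !idem.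
have comm1 (D : pzRingType) (x y : D) : GRing.comm x y -> GRing.comm x (1 - y).
  by move=> xy; apply: commrB => //; exact: commr1.
have cf : GRing.comm (ot a b) f.
  by rewrite /GRing.comm !(crossedM H) (comm1 _ _ _ ap) (comm1 _ _ _ bq).
split; first exact: idem.
- exact: comm1.
- move=> rho r0.
  have [C HC] := qnil_mul_le b 1 qp r0.
  have [C' HC'] := qnil_mul_le a (1 - p) qb r0.
  exists (C + C') => n.
  have -> : ot a b ^+ n * (1 - f) =
      ot (a ^+ n * p) (b ^+ n * 1) + ot (a ^+ n * (1 - p)) (b ^+ n * q).
    rewrite mulrBr mulr1 crossedX (crossedM H) [b ^+ n * (1 - q)]mulrBr (crossedBr H).
    rewrite mulr1 opprB addrCA addrC; congr (_ + _).
    by rewrite mulrBr !mulr1 (crossedBl H) subKr.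
  rewrite (le_trans (rnormD _ _))// mulrDl !(crossed_norm H) lerD //.
  by rewrite mulrC.
- exists (ot d d'); rewrite subKr !(crossedM H) ad da bd db; split=> //.
    rewrite mulrBr mulr1 (crossedM H) mulrBr mulr1 mulrBr mulr1.
    by rewrite dp dq !subr0 subrr.
  rewrite mulrBl mul1r (crossedM H) mulrBl mul1r mulrBl mul1r.
  by rewrite pd qd !subr0 subrr.
Qed.

Lemma crossed_idem_neq0l p q : p * p = p -> p != 0 -> 1 - ot (1 - p) (1 - q) != 0.
Proof.
move=> pp; apply: contraNneq => e0.
have : (1 - ot (1 - p) (1 - q)) * ot p 1 = 0 by rewrite e0 mul0r.
rewrite mulrBl mul1r (crossedM H) mulrBl mul1r pp subrr.
have -> : ot 0 ((1 - q) * 1) = 0 by apply/crossed_eq0; left.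
by rewrite subr0 => /crossed_eq0[-> //|/eqP]; rewrite oner_eq0.
Qed.

Lemma crossed_pole a b p q n m : spectral_idem a p -> spectral_idem b q ->
  p != 0 -> a ^+ n * p = 0 -> b ^+ m * q = 0 -> poles (ot a b) 0.
Proof.
move=> ap bq p0 anp bmq.
apply/poles0P; exists (1 - ot (1 - p) (1 - q)), (n + m)%N.
split; [by apply: crossed_idem_neq0l => //; case: ap|exact: crossed_spectral_idem|].
have anp' : a ^+ (n + m) * (1 - p) = a ^+ (n + m).
  by rewrite mulrBr mulr1 addnC exprD -mulrA anp mulr0 subr0.
have bmq' : b ^+ (n + m) * (1 - q) = b ^+ (n + m).
  by rewrite mulrBr mulr1 exprD -mulrA bmq mulr0 subr0.
by rewrite mulrBr mulr1 crossedX (crossedM H) anp' bmq' subrr.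
Qed.

End OneSide.

(** [p] may be any spectral idempotent, zero included: a pole of [a] gives (iv), an invertible [a]
    gives (v), an essential singularity gives (vi). *)
Lemma crossed_nonpole (A B T : banachAlgType R[i]) (ot : A -> B -> T) a b p :
  crossed ot -> ~ nilpotent_elt a -> spectral_idem a p -> nonpoles b 0 ->
  nonpoles (ot a b) 0.
Proof.
move=> H na ap /nonpoles0P[q [q0 bq bnq]].
have [qq _ qb _] := bq.
split.
  apply/isolated0_spectral_idem; exists (1 - ot (1 - p) (1 - q)).
    exact: (crossed_idem_neq0l (crossed_flip H)).
  exact: crossed_spectral_idem.
move=> /poles0P[e [n [_ ce cne]]].
have qf : qnil (ot a b) (ot 1 q).
  move=> rho r0; have [C HC] := qnil_mul_le a 1 qb r0; exists C => m.
  by rewrite (crossedX H) (crossedM H) (crossed_norm H) mulrC.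
have := spectral_idem_absorb ce cne qf.
rewrite (crossedX H) (crossedM H) mulr1 => /(crossed_eq0 H)[an|//].
  by apply: na; exists n.
exact: bnq.
Qed.

End Tensor.

(** * Slice maps and the spectrum of [a (x) b] *)

Section Slices.
Variable R : realType.

(* [S] is the slice map id (x) g for a functional g norming [y]. *)
Definition has_slices (A B T : banachAlgType R[i]) (ot : A -> B -> T) :=
  forall y : B, y != 0 -> exists S : T -> A,
    [/\ forall z z', S (z - z') = S z - S z',
        forall z, rnorm (S z) <= rnorm z,
        forall x, S (ot x y) = (rnorm y)%:C%C *: x,
        forall z x, S (z * ot x 1) = S z * x
      & forall z x, S (ot x 1 * z) = x * S z].

Lemma unit_left_right (A : unitRingType) (a u v : A) :
  u * a \is a GRing.unit -> a * v \is a GRing.unit -> a \is a GRing.unit.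
Proof.
move=> ua av; have l : (u * a)^-1 * u * a = 1 by rewrite -mulrA mulVr.
have r : a * (v * (a * v)^-1) = 1 by rewrite mulrA mulrV.
apply/unitrP; exists ((u * a)^-1 * u); split=> //.
have -> // : (u * a)^-1 * u = v * (a * v)^-1 by rewrite -[LHS]mulr1 -r mulrA l mul1r.
Qed.

(* Points of the spectrum of maximal modulus along a ray are approximate
   eigenvalues, simultaneously on both sides. *)
Lemma two_sided_divisor (B : banachAlgType R[i]) (b : B) m0 : m0 != 0 ->
  m0%:A - b \isn't a GRing.unit ->
  exists2 m : R[i], m != 0 & forall eta : R, 0 < eta -> exists2 y : B, y != 0 &
    rnorm ((m%:A - b) * y) <= eta * rnorm y /\ rnorm (y * (m%:A - b)) <= eta * rnorm y.
Proof.
move=> m00 m0b; have cm0 : 0 < cmod m0 by rewrite cmod_gt0.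
(* Moving outward from [m0], past the supremum everything is invertible; inverses taken just beyond
   it have large norm and serve as [y]. *)
pose E : set R := [set t | 1 <= t /\ (t%:C%C * m0)%:A - b \isn't a GRing.unit].
have E1 : E 1 by split; rewrite // rmorph1 mul1r.
have Eub : ubound E (rnorm b / cmod m0).
  move=> t [t1 /(spectrum_pow_le 1)]; rewrite !expr1 cmodM cmodR ger0_norm.
    by rewrite ler_pdivlMr.
  exact: le_trans t1.
have Esup : has_sup E by split; [exists 1|exists (rnorm b / cmod m0)].
pose ts := sup E; have ts1 : 1 <= ts by apply: ub_le_sup => //; case: Esup.
exists (ts%:C%C * m0).
  by rewrite mulf_neq0 // eq_complex /= eqxx andbT gt_eqF // (lt_le_trans ltr01).
move=> eta eta0; pose N1 := rnorm (1 : B).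
have N11 : 1 <= N1 := rnorm1_ge1 B.
have N10 : 0 < N1 := lt_le_trans ltr01 N11.
(* [(m - b) y = 1 - delta m0 y]. A noninvertible point within distance [2 delta |m0|] forces [y] to
   be so large that both terms are at most half of [eta] times the norm of [y]. *)
pose delta := eta / 2 / (2 * cmod m0 * N1 * N1).
have D0 : 0 < 2 * cmod m0 * N1 * N1 by rewrite !mulr_gt0.
have d0 : 0 < delta by rewrite !divr_gt0.
have dE : delta * (2 * cmod m0 * N1 * N1) = eta / 2 by rewrite mulfVK ?gt_eqF.
have [t' [t'1 t'b] t'd] := sup_adherent d0 Esup.
have t'ts : t' <= ts by apply: ub_le_sup; [case: Esup|split].
pose s := ts + delta.
have s1 : 1 <= s by rewrite (le_trans ts1) // lerDl ltW.
have su : (s%:C%C * m0)%:A - b \is a GRing.unit.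
  apply: contraT => sb; have : s <= ts by apply: ub_le_sup; [case: Esup|split].
  by rewrite leNgt /s ltrDl d0.
pose y := ((s%:C%C * m0)%:A - b)^-1; have y0 : y != 0.
  by rewrite invr_eq0; apply: contraTneq su => ->; rewrite unitr0.
have hy : 1 <= rnorm y * (2 * delta * cmod m0 * N1).
  rewrite leNgt; apply: contra t'b => h; apply: (unit_perturb su).
  apply: le_lt_trans h; rewrite -/y ler_wpM2l ?rnorm_ge0 //.
  have -> : (s%:C%C * m0)%:A - b - ((t'%:C%C * m0)%:A - b) = ((s - t')%:C%C * m0)%:A.
    by rewrite opprB addrA subrK -scalerBl -mulrBl -rmorphB.
  rewrite rnormZ cmodM cmodR ler_wpM2r ?rnorm_ge0 // ler_wpM2r ?cmod_ge0 //.
  rewrite ger0_norm; last by rewrite subr_ge0 (le_trans t'ts) // lerDl ltW.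
  by rewrite /s; move: t'd; rewrite -/ts; lra.
exists y => //.
have sE : (ts%:C%C * m0)%:A - b = ((s%:C%C * m0)%:A - b) - (delta%:C%C * m0)%:A.
  by rewrite addrAC -scalerBl -mulrBl -rmorphB /s addrK.
have bnd : rnorm (1 - (delta%:C%C * m0) *: y) <= eta * rnorm y.
  apply: (le_trans (rnormB _ _)); rewrite rnormZ cmodM cmodR (ger0_norm (ltW d0)) -/N1.
  have y0' := rnorm_ge0 y; have k1 : N1 <= eta / 2 * rnorm y.
    by rewrite -dE; have := ler_wpM2l (ltW N10) hy; rewrite mulr1; lra.
  have k2 : delta * cmod m0 <= eta / 2.
    have h1 : 1 <= 2 * (N1 * N1) by have := ler_pM ler01 ler01 N11 N11; lra.
    have := ler_peMr (mulr_ge0 (ltW d0) (ltW cm0)) h1; lra.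
  have := ler_wpM2r y0' k2; lra.
rewrite sE mulrBl mulrBr mulVr // mulrV // mulr_algl mulr_algr.
by split.
Qed.

Section Main.
Variables (A B T : banachAlgType R[i]) (ot : A -> B -> T).
Hypotheses (H : crossed ot) (sl : has_slices ot).

(** Slicing at [y = 1] turns [c^-1 (1 (x) b)] and [(1 (x) b) c^-1], for [c = a (x) b], into
    one-sided inverses of [a] up to the scalar norm of 1. *)
Lemma crossed_unitl a b : ot a b \is a GRing.unit -> a \is a GRing.unit.
Proof.
move=> cu; have [S [SB SN S1 Sr Sl]] := sl (oner_neq0 B).
have N1 : (rnorm (1 : B))%:C%C \is a @GRing.unit R[i].
  rewrite unitfE eq_complex /= eqxx andbT gt_eqF //.
  exact: lt_le_trans (rnorm1_ge1 B).
have su x : (rnorm (1 : B))%:C%C *: 1 = x -> x \is a @GRing.unit A.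
  by move=> <-; rewrite scaler_unit // unitr1.
apply: (@unit_left_right _ _ (S ((ot a b)^-1 * ot 1 b)) (S (ot 1 b * (ot a b)^-1))).
  apply: su; rewrite -Sr -S1 (crossed1 H) -mulrA (crossedM H) mul1r mulr1.
  by rewrite mulVr.
apply: su; rewrite -Sl -S1 (crossed1 H) mulrA (crossedM H) mul1r mulr1.
by rewrite mulrV.
Qed.

Lemma crossed_spectrum a b l m :
  (forall eta : R, 0 < eta -> exists2 y : B, y != 0 &
    rnorm ((m%:A - b) * y) <= eta * rnorm y /\ rnorm (y * (m%:A - b)) <= eta * rnorm y) ->
  l%:A - a \isn't a GRing.unit -> (l * m)%:A - ot a b \isn't a GRing.unit.
Proof.
move=> div; apply: contra => cu; set c' := ((l * m)%:A - ot a b)^-1.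
pose K := rnorm c' * rnorm a + 1.
have K0 : 0 < K by rewrite ltr_wpDl // mulr_ge0 ?rnorm_ge0.
have e0 : 0 < (2 * K)^-1 by rewrite invr_gt0 mulr_gt0.
have [y y0 [hl hr]] := div _ e0; have [S [SB SN S1 Sr Sl]] := sl y0.
have S0 : S 0 = 0 by rewrite -(subrr 0) SB subrr.
have SD z z' : S (z + z') = S z + S z'.
  have -> : z + z' = z - (0 - z') by rewrite sub0r opprK.
  by rewrite !SB S0 sub0r opprK.
have ny : 0 < rnorm y by rewrite rnorm_gt0.
pose k : R[i] := (rnorm y)%:C%C^-1.
have kE : k *: ((rnorm y)%:C%C *: (1 : A)) = 1.
  by rewrite scalerA mulVf ?scale1r // eq_complex /= eqxx andbT gt_eqF.
have ck : cmod k = (rnorm y)^-1 by rewrite cmodV cmodR ger0_norm // ltW.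
have small (x : T) (w : B) : rnorm w <= (2 * K)^-1 * rnorm y ->
    rnorm x <= rnorm c' * (rnorm a * rnorm w) -> rnorm (k *: S x) < 1.
  move=> hw hx; rewrite rnormZ ck mulrC ltr_pdivrMr // mul1r.
  apply: le_lt_trans (SN _) _; apply: le_lt_trans hx _.
  have h := ler_wpM2l (mulr_ge0 (rnorm_ge0 c') (rnorm_ge0 a)) hw.
  rewrite mulrA; apply: (le_lt_trans h).
  have : rnorm c' * rnorm a * (2 * K)^-1 < 1.
    by rewrite ltr_pdivrMr ?mulr_gt0 // /K; have := mulr_ge0 (rnorm_ge0 c') (rnorm_ge0 a); lra.
  by rewrite mulrA gtr_pMl.
have algE : (l * m)%:A = ot l%:A m%:A by rewrite (crossedZ H) (crossed1 H).
apply: (@unit_left_right _ _ (k *: S (c' * ot 1 (m *: y))) (k *: S (ot 1 (m *: y) * c'))).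
  (* From [(l m - a (x) b)(1 (x) y) = (l - a) (x) m y + a (x) (m - b) y]. Slicing and dividing by
     the norm of [y] gives a left inverse of [l - a] up to an error below 1; the choice of [K]
     ensures this. *)
  have E : ot 1 y = c' * ot 1 (m *: y) * ot (l%:A - a) 1 + c' * ot a ((m%:A - b) * y).
    rewrite -mulrA -mulrDr (crossedM H) mul1r mulr1 -[LHS]mul1r -(mulVr cu) -/c' -mulrA.
    congr (_ * _); rewrite algE mulrBl !(crossedM H) !mulr1 mulr_algl.
    by rewrite mulrBl mulr_algl (crossedBl H) (crossedBr H) addrA subrK.
  apply: near1_unit.
  have -> : 1 - k *: S (c' * ot 1 (m *: y)) * (l%:A - a) = k *: S (c' * ot a ((m%:A - b) * y)).
    by rewrite -{1}kE -S1 E SD Sr scalerDr scalerAl addrC addKr.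
  apply: small hl _.
  by rewrite (le_trans (rnormM _ _))// (crossed_norm H).
have E : ot 1 y = ot (l%:A - a) 1 * (ot 1 (m *: y) * c') + ot a (y * (m%:A - b)) * c'.
  rewrite mulrA -mulrDl (crossedM H) mul1r mulr1 -[LHS]mulr1 -(mulrV cu) -/c' mulrA.
  congr (_ * _); rewrite algE mulrBr !(crossedM H) !mul1r mulr_algr.
  by rewrite mulrBr mulr_algr (crossedBl H) (crossedBr H) addrA subrK.
apply: near1_unit.
have -> : 1 - (l%:A - a) * (k *: S (ot 1 (m *: y) * c')) = k *: S (ot a (y * (m%:A - b)) * c').
  by rewrite -{1}kE -S1 E SD Sl scalerDr scalerAr addrC addKr.
apply: small hr _.
by rewrite (le_trans (rnormM _ _))// (crossed_norm H) mulrC.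
Qed.

Lemma crossed_acc a b : spectrum b <> [set 0] -> acc (spectrum a) 0 ->
  acc (spectrum (ot a b)) 0.
Proof.
move=> sb [/spectrum0E a0 na].
have [m0 m00 m0b] : exists2 l, l != 0 & l%:A - b \isn't a GRing.unit.
  apply: contrapT => h; apply: sb; apply/qnil_spectrum/spectrum_sub0_qnil => l l0.
  by apply: contraT => lx; exfalso; apply: h; exists l.
have [m m0' div] := two_sided_divisor m00 m0b.
split; first by apply/spectrum0E; apply: contra a0; exact: crossed_unitl.
move=> /isolated0P[_ [r r0 hr]]; apply: na; apply/isolated0P; split.
  exact/spectrum0E.
exists (r / `|m|); first by rewrite divr_gt0 // normr_gt0.
move=> l /andP[l0 lr] la; apply: (hr (l * m)).
  rewrite normrM mulr_gt0 ?normr_gt0 // -?normr_gt0 //=.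
  by rewrite -ltr_pdivlMr // normr_gt0.
exact: crossed_spectrum.
Qed.

End Main.
End Slices.

(** * Norming functionals and slice maps *)

Section HahnBanach.
Variables (R : realType) (B : normedAlgType R[i]).
Implicit Types (x y : B) (t : R) (u v : B * R) (G : set (B * R)).

(* Graph of a real-linear functional, defined on a real subspace and dominated
   by the norm. *)
Definition dominated G :=
  (forall t u v, G u -> G v -> G (t%:C%C *: u.1 + v.1, t * u.2 + v.2)) /\
  forall u, G u -> u.2 <= rnorm u.1.

Lemma rnormZR t x : rnorm (t%:C%C *: x) = `|t| * rnorm x.
Proof. by rewrite rnormZ cmodR. Qed.

Lemma dominated_extend G x1 : dominated G -> G (0, 0) ->
  exists c : R, dominated [set u | exists t v, G v /\ u = (t%:C%C *: x1 + v.1, t * c + v.2)].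
Proof.
move=> [lin dom] G0.
have scl t v : G v -> G (t%:C%C *: v.1, t * v.2).
  by move=> Gv; have := lin t _ _ Gv G0; rewrite /= !addr0.
have key u v : G u -> G v -> u.2 - rnorm (u.1 - x1) <= rnorm (v.1 + x1) - v.2.
  move=> Gu Gv; have := dom _ (lin 1 _ _ Gu Gv); rewrite /= rmorph1 scale1r mul1r.
  have := rnormD (u.1 - x1) (v.1 + x1); rewrite addrACA addNr addr0; lra.
pose E := [set r : R | exists2 u, G u & r = u.2 - rnorm (u.1 - x1)].
have E0 : E (0 - rnorm (0 - x1)) by exists (0, 0).
have Eub v : G v -> ubound E (rnorm (v.1 + x1) - v.2).
  by move=> Gv r [u Gu ->]; exact: key.
have Es : has_sup E.
  by split; [exists (0 - rnorm (0 - x1))|exists (rnorm (0 + x1) - 0); exact: Eub G0].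
exists (sup E).
have lo u : G u -> u.2 - rnorm (u.1 - x1) <= sup E.
  by move=> Gu; apply: ub_le_sup; [case: Es|exists u].
have hi v : G v -> sup E <= rnorm (v.1 + x1) - v.2.
  by move=> Gv; apply: ge_sup; [case: Es|exact: Eub].
split.
  move=> t _ _ [r [u [Gu ->]]] [s [v [Gv ->]]];
  exists (t * r + s), (t%:C%C *: u.1 + v.1, t * u.2 + v.2).
  split; first exact: lin.
  congr (_, _) => /=; last by rewrite mulrDr mulrDl mulrA addrACA.
  by rewrite scalerDr scalerA rmorphD rmorphM scalerDl addrACA.
move=> _ [t [v [Gv ->]]] /=.
have [t0|t0|->] := ltgtP t 0; last by rewrite scale0r mul0r !add0r; exact: dom.
- have nt : 0 < - t by rewrite oppr_gt0.
  have := lo _ (scl (- t)^-1 v Gv); rewrite /=.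
  have -> : (- t)^-1%:C%C *: v.1 - x1 = (- t)^-1%:C%C *: (t%:C%C *: x1 + v.1).
    rewrite scalerDr scalerA -rmorphM /= invrN mulNr mulVf ?lt_eqF //.
    by rewrite rmorphN1 scaleN1r addrC.
  rewrite rnormZR gtr0_norm ?invr_gt0 // -mulrBr mulrC ler_pdivrMr //.
  lra.
- have := hi _ (scl t^-1 v Gv); rewrite /=.
  have -> : t^-1%:C%C *: v.1 + x1 = t^-1%:C%C *: (t%:C%C *: x1 + v.1).
    by rewrite scalerDr scalerA -rmorphM /= mulVf ?gt_eqF // rmorph1 scale1r addrC.
  rewrite rnormZR gtr0_norm ?invr_gt0 // -mulrBr mulrC ler_pdivlMr //.
  lra.
Qed.

Lemma real_hahn_banach y : exists f : B -> R,
  [/\ forall t x x', f (t%:C%C *: x + x') = t * f x + f x',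
      forall x, f x <= rnorm x & f y = rnorm y].
Proof.
pose L : set (B * R) := [set u | exists t, u = (t%:C%C *: y, t * rnorm y)].
have Ldom : dominated L.
  split=> [t _ _ [r ->] [s ->]|_ [t ->]] /=.
    by exists (t * r + s); rewrite rmorphD rmorphM scalerDl scalerA mulrDl mulrA.
  by rewrite rnormZR ler_wpM2r ?rnorm_ge0 // ler_norm.
(* Adjoining [L] in the predicate, rather than requiring [L] inside [G], lets the empty chain
   qualify and still makes the maximal functional extend [L]. *)
have [|M [MP Mmax]] := @Zorn_bigcup (B * R)%type (fun G => dominated (G `|` L)).
  move=> F FP Ftot; split.
    move=> t u v [[G FG Gu]|Lu] [[G' FG' Gv]|Lv].
    - have [GG'|G'G] := Ftot _ _ FG FG'.
        have [lin _] := FP _ FG'; have := lin t u v (or_introl (GG' _ Gu)) (or_introl Gv).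
        by case=> ?; [left; exists G'|right].
      have [lin _] := FP _ FG; have := lin t u v (or_introl Gu) (or_introl (G'G _ Gv)).
      by case=> ?; [left; exists G|right].
    - have [lin _] := FP _ FG; have := lin t u v (or_introl Gu) (or_intror Lv).
      by case=> ?; [left; exists G|right].
    - have [lin _] := FP _ FG'; have := lin t u v (or_intror Lu) (or_introl Gv).
      by case=> ?; [left; exists G'|right].
    - by have [lin _] := Ldom; right; exact: lin.
  move=> u [[G FG Gu]|Lu]; last by case: Ldom => _; exact.
  by have [_ dom] := FP _ FG; apply: dom; left.
pose G := M `|` L; have [lin dom] : dominated G := MP.
have G0 : G (0, 0) by right; exists 0; rewrite scale0r mul0r.
have total x : exists r, G (x, r).
  have [c cdom] := dominated_extend x MP G0.
  set G' := [set u | _] in cdom.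
  have GG' : G `<=` G' by move=> [u1 u2] Gu; exists 0, (u1, u2); rewrite scale0r mul0r !add0r.
  have G'1 : G' (x, c) by exists 1, (0, 0); rewrite rmorph1 scale1r mul1r !addr0.
  have G'L : G' `|` L = G' by apply/setUidl => u Lu; apply: GG'; right.
  exists c; apply: contrapT => Gxc; apply: (Mmax G'); last by rewrite G'L.
  split; first by move=> u Mu; apply: GG'; left.
  by move=> G'M; apply: Gxc; left; exact: G'M.
have uniq x r r' : G (x, r) -> G (x, r') -> r = r'.
  have half s s' : G (x, s) -> G (x, s') -> s <= s'.
    move=> h h'; have := dom _ (lin (-1) _ _ h' h).
    rewrite /= rmorphN rmorph1 scaleN1r addNr rnorm0; lra.
  by move=> h h'; apply/eqP; rewrite eq_le !half.
have [f Gf] : exists f : B -> R, forall x, G (x, f x).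
  by exists (fun x => sval (cid (total x))) => x; case: cid.
exists f; split=> [t x x'|x|].
- apply: uniq (Gf _) _; exact: lin t _ _ (Gf x) (Gf x').
- exact: dom (Gf x).
- by apply: uniq (Gf _) _; right; exists 1; rewrite rmorph1 scale1r mul1r.
Qed.

(** Complexification [g x = f x - i f (i x)]. Rotating [x] until [g x] is real carries over the
    bound of [f]; at [y] the real part already exhausts the norm, so the imaginary part vanishes. *)
Lemma norming_functional y : exists g : B -> R[i],
  [/\ forall l x x', g (l *: x + x') = l * g x + g x',
      forall x, cmod (g x) <= rnorm x & g y = (rnorm y)%:C%C].
Proof.
have [f [flin fdom fy]] := real_hahn_banach y.
have f0 : f 0 = 0 by have := flin 1 0 0; rewrite scaler0 addr0 mul1r; lra.
have fD x x' : f (x + x') = f x + f x'.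
  by have := flin 1 x x'; rewrite rmorph1 scale1r mul1r.
have fZ t x : f (t%:C%C *: x) = t * f x by have := flin t x 0; rewrite f0 !addr0.
pose g x : R[i] := (f x +i* - f ('i%C *: x))%C.
have gD x x' : g (x + x') = g x + g x'.
  by apply/eqP; rewrite eq_complex /= scalerDr !fD opprD !eqxx.
have gZR t x : g (t%:C%C *: x) = t%:C%C * g x.
  have ic : 'i%C *: (t%:C%C *: x) = t%:C%C *: ('i%C *: x) by rewrite !scalerA mulrC.
  apply/eqP; rewrite eq_complex /= ic !fZ.
  by rewrite !mul0r subr0 addr0 mulrN !eqxx.
have gi x : g ('i%C *: x) = 'i%C * g x.
  apply/eqP; rewrite eq_complex /= scalerA -expr2 sqr_i scaleN1r.
  have -> : f (- x) = - f x by have := fD x (- x); rewrite subrr f0; lra.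
  by rewrite !mul0r !mul1r sub0r !opprK add0r !eqxx.
have gZ l x : g (l *: x) = l * g x.
  by rewrite {1 2}(complexE l) scalerDl gD -scalerA gi !gZR mulrDl mulrA.
have glin l x x' : g (l *: x + x') = l * g x + g x' by rewrite gD gZ.
have gN x : cmod (g x) <= rnorm x.
  have [->|gx0] := eqVneq (g x) 0; first by rewrite cmod0 rnorm_ge0.
  have cg : 0 < cmod (g x) by rewrite cmod_gt0.
  pose th := (cmod (g x))%:C%C / g x.
  have cth : cmod th = 1 by rewrite cmodM cmodV cmodR ger0_norm ?(ltW cg) // mulfV // gt_eqF.
  have : g (th *: x) = (cmod (g x))%:C%C by rewrite gZ mulfVK.
  move=> /(congr1 (@complex.Re R)) /= <-.
  by rewrite (le_trans (fdom _)) // rnormZ cth mul1r.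
exists g; split=> //.
have gy : complex.Re (g y) = rnorm y by rewrite /= fy.
have := gN y; rewrite /cmod normc_def /= -/(g y) => h.
have I0 : (complex.Im (g y)) ^+ 2 <= 0.
  have h2 : Num.sqrt (complex.Re (g y) ^+ 2 + complex.Im (g y) ^+ 2) ^+ 2 <= rnorm y ^+ 2.
    by rewrite lerXn2r ?nnegrE ?sqrtr_ge0 ?rnorm_ge0.
  by rewrite sqr_sqrtr ?addr_ge0 ?sqr_ge0 // gy gerDl in h2.
have : complex.Im (g y) = 0.
  by apply/eqP; rewrite -sqrf_eq0 eq_le I0 sqr_ge0.
by move: gy; case: (g y) => u v /= -> ->.
Qed.

End HahnBanach.

(** * Slice maps on the algebraic tensor product and on its completion *)

Section TensorSlices.
Variable R : realType.

Lemma mk_linear (K : pzRingType) (U V : lmodType K) (f : U -> V) :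
  linear f -> exists g : {linear U -> V}, forall x, g x = f x.
Proof.
move=> lf; pose g : {linear U -> V} := HB.pack f (GRing.isLinear.Build _ _ _ _ f lf).
by exists g.
Qed.

Lemma mk_bilinear (K : nzRingType) (U U' V : lmodType K) (f : U -> U' -> V) :
  (forall y, linear (f ^~ y)) -> (forall x, linear (f x)) ->
  exists g : {bilinear U -> U' -> V}, forall x y, g x y = f x y.
Proof.
move=> fl fr.
pose g : {bilinear U -> U' -> V} :=
  HB.pack f (bilinear_isBilinear.Build K U U' V *:%R *:%R f (fl, fr)).
by exists g.
Qed.

Lemma bounded_linearP (A B : normedAlgType R[i]) (U : {linear A -> B}) (C : R) :
  (forall x, rnorm (U x) <= C * rnorm x) -> bounded_linear U.
Proof.
move=> UC; pose C1 := `|C|.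
exists C1%:C%C; split; first by rewrite ger0_real // ler0c normr_ge0.
move=> M CM; apply/nbhs_ballP; exists 1 => //= x.
rewrite -ball_normE /= sub0r normrN => x1.
have x1' : rnorm x < 1 by move: x1; rewrite -ltcR -rnormE; exact.
apply: le_trans (ltW CM).
have : rnorm (U x) <= C1.
  apply: (le_trans (UC x)); apply: le_trans (_ : C1 * rnorm x <= _).
    by rewrite ler_wpM2r ?rnorm_ge0 // ler_norm.
  by rewrite ler_piMr ?normr_ge0 // ltW.
by rewrite -lecR -rnormE; exact.
Qed.

Lemma opnorm_le (A B : normedAlgType R[i]) (U : A -> B) (C : R) : 0 <= C ->
  (forall x, rnorm (U x) <= C * rnorm x) -> 0 <= opnorm U <= C%:C%C.
Proof.
move=> C0 UC; rewrite /opnorm ler0c lecR; set E := [set _ | _ in _].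
have ub : ubound E C.
  move=> _ [x /= x1 <-]; apply: (le_trans (UC x)); rewrite ler_piMr //.
  by move: x1; rewrite rnormE -lecR.
have E0 : E (rnorm (U 0)).
  by exists 0 => //=; rewrite rnormE rnorm0 ler01.
apply/andP; split; last by apply: ge_sup => //; exists (rnorm (U 0)).
apply: le_trans (rnorm_ge0 (U 0)) _; apply: ub_le_sup => //; by exists C.
Qed.

(** Uniformity is applied to the identity of [A] and to [y |-> g y *: 1]: their tensor product sends
    [z] to [S z (x) 1]. The crossnorm then yields the norm of 1 as a factor on both sides, and it
    cancels. *)
Lemma tensor_slice (A B : banachAlgType R[i]) (AB : normedAlgType R[i])
    (otimes : {bilinear A -> B -> AB}) (g : B -> R[i]) :
  is_tensor_algebra otimes -> crossnorm otimes -> uniform_norm otimes ->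
  (forall l y y', g (l *: y + y') = l * g y + g y') ->
  (forall y, cmod (g y) <= rnorm y) ->
  exists S : {linear AB -> A},
    (forall x y, S (otimes x y) = g y *: x) /\ forall z, rnorm (S z) <= rnorm z.
Proof.
move=> [lift ext mul one] cross unif glin gN.
have [f fE] : exists f : {bilinear A -> B -> A}, forall x y, f x y = g y *: x.
  apply: mk_bilinear => [y l u v|x l u v].
    by rewrite scalerDr !scalerA mulrC.
  by rewrite glin scalerDl scalerA.
have [S SE] := lift A f.
exists S; split=> [x y|z]; first by rewrite SE fE.
have [V VE] : exists V : {linear B -> B}, forall y, V y = g y *: 1.
  by apply: mk_linear => l u v; rewrite glin scalerDl scalerA.
have [U UE] : exists U : {linear A -> A}, forall x, U x = x.
  by apply: mk_linear.
have [UV UVE] : exists UV : {linear AB -> AB}, forall z, UV z = otimes (S z) 1.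
  apply: mk_linear => l u v.
  by rewrite linearP linearDl linearZl_LR.
have Ub x : rnorm (U x) <= 1 * rnorm x by rewrite UE mul1r.
have Vb y : rnorm (V y) <= rnorm (1 : B) * rnorm y.
  by rewrite VE rnormZ mulrC ler_wpM2l ?rnorm_ge0.
have := unif U V UV (bounded_linearP Ub) (bounded_linearP Vb).
have UVot x y : UV (otimes x y) = otimes (U x) (V y).
  by rewrite UVE SE fE UE VE linearZl_LR linearZr_LR.
move=> /(_ UVot z); rewrite UVE cross.
have /andP[U0 U1] := opnorm_le ler01 Ub; have /andP[V0 V1] := opnorm_le (rnorm_ge0 (1 : B)) Vb.
have UV1 : opnorm U * opnorm V <= (1 * rnorm (1 : B))%:C%C.
  by rewrite rmorphM ler_pM.
have z0 : 0 <= anorm z by rewrite rnormE ler0c rnorm_ge0.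
move=> /le_trans /(_ (ler_wpM2r z0 UV1)).
rewrite !rnormE -!rmorphM lecR mul1r mulrC ler_pM2l //.
exact: lt_le_trans (rnorm1_ge1 B).
Qed.

Lemma completion_slices (A B : banachAlgType R[i]) (AB : normedAlgType R[i])
    (otimes : {bilinear A -> B -> AB}) (T : banachAlgType R[i])
    (iota : {lrmorphism AB -> T}) :
  is_tensor_algebra otimes -> crossnorm otimes -> uniform_norm otimes ->
  is_completion iota -> has_slices (fun x y => iota (otimes x y)).
Proof.
move=> ten cross unif [iso dns] y y0.
have [g [glin gN gy]] := norming_functional y.
have [S [SE SN]] := tensor_slice ten cross unif glin gN.
have [lift ext mul one] := ten.
have iN z : rnorm (iota z) = rnorm z by rewrite /rnorm iso.
have Sr z x : S (z * otimes x 1) = S z * x.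
  have [h1 h1E] : exists h : {linear AB -> A}, forall z, h z = S (z * otimes x 1).
    by apply: mk_linear => l u v; rewrite mulrDl -scalerAl linearP.
  have [h2 h2E] : exists h : {linear AB -> A}, forall z, h z = S z * x.
    by apply: mk_linear => l u v; rewrite linearP mulrDl -scalerAl.
  rewrite -h1E -h2E; apply: ext => u v.
  by rewrite h1E h2E mul !SE mulr1 scalerAl.
have Sl z x : S (otimes x 1 * z) = x * S z.
  have [h1 h1E] : exists h : {linear AB -> A}, forall z, h z = S (otimes x 1 * z).
    by apply: mk_linear => l u v; rewrite mulrDr -scalerAr linearP.
  have [h2 h2E] : exists h : {linear AB -> A}, forall z, h z = x * S z.
    by apply: mk_linear => l u v; rewrite linearP mulrDr -scalerAr.
  rewrite -h1E -h2E; apply: ext => u v.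
  by rewrite h1E h2E mul !SE mul1r scalerAr.
(* The graph of the continuous extension of [S]: contractivity gives uniqueness, density and
   completeness of [A] give existence, and each algebraic rule passes to the limit. *)
pose Q z s := forall e : R, 0 < e -> exists w, rnorm (z - iota w) < e /\ rnorm (s - S w) < e.
have approx (z : T) (e : R) : 0 < e -> exists w, rnorm (z - iota w) < e.
  move=> e0; have ec : 0 < e%:C%C :> R[i] by rewrite ltcR.
  have [||t [ht [w _ wt]]] := dns (ball (z : normed_space T) e%:C%C).
  - by exists z; exact: ballxx.
  - exact: ball_open.
  exists w; rewrite -wt -ball_normE /= in ht.
  by move: ht; rewrite -ltcR -rnormE; exact.
have Qiota w : Q (iota w) (S w) by move=> e e0; exists w; rewrite !subrr !rnorm0.
have subACA (V : zmodType) (a b c d : V) : a - b - (c - d) = a - c - (b - d).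
  by rewrite !opprB addrACA [RHS]addrACA [- b - c]addrC.
have QB z z' s s' : Q z s -> Q z' s' -> Q (z - z') (s - s').
  move=> q q' e e0; have e2 : 0 < e / 2 by rewrite divr_gt0.
  have [w [h1 h2]] := q _ e2; have [w' [h1' h2']] := q' _ e2; exists (w - w').
  rewrite (raddfB iota w w') (raddfB S w w') (subACA _ z) (subACA _ s) (splitr e); split.
    by rewrite (le_lt_trans (rnormB _ _)) // ltrD.
  by rewrite (le_lt_trans (rnormB _ _)) // ltrD.
have QN z s : Q z s -> rnorm s <= rnorm z.
  move=> q; apply: le_small => e e0; have e2 : 0 < e / 2 by rewrite divr_gt0.
  have [w [h1 h2]] := q _ e2.
  have := SN w; have := rnormD (s - S w) (S w); rewrite subrK -(iN w).
  have := rnormB z (z - iota w); rewrite subKr; lra.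
have Quniq z s s' : Q z s -> Q z s' -> s = s'.
  move=> q q'; apply/eqP; rewrite -subr_eq0; apply/eqP/rnorm0_eq0/eqP.
  by rewrite eq_le rnorm_ge0 andbT (le_trans (QN _ _ (QB _ _ _ _ q q'))) // subrr rnorm0.
have Qex z : exists s, Q z s.
  have w_ n : exists w, rnorm (z - iota w) < 2^-1 ^+ n.
    by apply: approx; rewrite exprn_gt0.
  have [w hw] := choice w_.
  have h2 : 0 <= (2^-1 : R) < 1 by lra.
  have [|s hs] := geometric_rcvg (C := 2) (u := fun n => S (w n)) h2.
    move=> n; rewrite -linearB (le_trans (SN _))// -iN raddfB /=.
    rewrite -(subrKA z) (le_trans (rnormD _ _))//.
    have := hw n; have := hw n.+1; rewrite exprS rnorm_distC.
    have : 0 < 2^-1 ^+ n :> R by rewrite exprn_gt0.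
    lra.
  exists s => e e0; have [n1 H1] := hs e e0.
  have [|n2 H2] := @exp_lt_small R 2^-1 e _ e0; first by lra.
  exists (w (maxn n1 n2)); split; last by rewrite rnorm_distC H1 // leq_maxl.
  by apply: lt_trans (hw _) _; apply: H2; exact: leq_maxr.
have [S' QS] := choice Qex.
have Nx x : rnorm (iota (otimes x 1)) = rnorm x * rnorm (1 : B).
  by rewrite iN /rnorm cross !rnormE -rmorphM.
(* One tolerance serves multiplication by [x] in [A] and by [x (x) 1] in the completion, whose norm
   carries the extra factor [rnorm 1]. *)
have small (x : A) (e t : R) : 0 <= t -> t < e / (rnorm x + rnorm x * rnorm (1 : B) + 1) ->
    t * rnorm x < e /\ t * (rnorm x * rnorm (1 : B)) < e.
  have x0 := rnorm_ge0 x; have x1 := mulr_ge0 x0 (rnorm1_ge0 B).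
  move=> t0; rewrite ltr_pdivlMr; last lra.
  have := mulr_ge0 t0 x0; have := mulr_ge0 t0 x1; lra.
have small0 (x : A) (e : R) : 0 < e -> 0 < e / (rnorm x + rnorm x * rnorm (1 : B) + 1).
  by move=> e0; rewrite divr_gt0 // ltr_wpDl // addr_ge0 ?mulr_ge0 ?rnorm_ge0.
exists S'; split.
- by move=> z z'; apply: Quniq (QS _) _; exact: QB.
- by move=> z; exact: QN (QS z).
- by move=> x; rewrite -gy -SE; apply: Quniq (QS _) (Qiota _).
- move=> z x; apply: Quniq (QS _) _ => e e0.
  have [w [h1 h2]] := QS z _ (small0 x e e0); exists (w * otimes x 1).
  have [_ k1] := small _ _ _ (rnorm_ge0 _) h1; have [k2 _] := small _ _ _ (rnorm_ge0 _) h2.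
  rewrite rmorphM /= Sr -!mulrBl; split; apply: le_lt_trans (rnormM _ _) _ => //.
  by rewrite Nx.
- move=> z x; apply: Quniq (QS _) _ => e e0.
  have [w [h1 h2]] := QS z _ (small0 x e e0); exists (otimes x 1 * w).
  have [_ k1] := small _ _ _ (rnorm_ge0 _) h1; have [k2 _] := small _ _ _ (rnorm_ge0 _) h2.
  rewrite rmorphM /= Sl -!mulrBr; split; apply: le_lt_trans (rnormM _ _) _.
    by rewrite Nx mulrC.
  by rewrite mulrC.
Qed.

End TensorSlices.

Section CompletedTensor.
Variables (R : realType) (A B : banachAlgType R[i]) (AB : normedAlgType R[i]).
Variables (otimes : {bilinear A -> B -> AB}).

(** Gives slices along the other factor, as needed for the second half of (vii), without changing
    [AB] or its completion. *)
Lemma tensor_flip : is_tensor_algebra otimes -> crossnorm otimes -> uniform_norm otimes ->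
  exists ot : {bilinear B -> A -> AB}, [/\ forall y x, ot y x = otimes x y,
    is_tensor_algebra ot, crossnorm ot & uniform_norm ot].
Proof.
move=> [lift ext mul one] cross unif.
have [ot otE] : exists ot : {bilinear B -> A -> AB}, forall y x, ot y x = otimes x y.
  by apply: mk_bilinear => [x l u v|y l u v]; rewrite ?linearPr ?linearPl.
exists ot; split=> //.
- split=> [W f|W g h gh|y y' x x'|]; rewrite ?otE //.
  + have [f' f'E] : exists f' : {bilinear A -> B -> W}, forall x y, f' x y = f y x.
      by apply: mk_bilinear => [x l u v|y l u v]; rewrite ?linearPr ?linearPl.
    by have [g gE] := lift W f'; exists g => y x; rewrite otE gE f'E.
  + by apply: ext => x y; rewrite -!otE gh.
- by move=> y x; rewrite otE cross mulrC.
- move=> V U UV Vb Ub UVE z; rewrite [opnorm V * _]mulrC.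
  by apply: (unif U V UV Ub Vb) => x y; rewrite -!otE UVE.
Qed.

Variables (T : banachAlgType R[i]) (iota : {lrmorphism AB -> T}).

Lemma crossed_completion : is_tensor_algebra otimes -> crossnorm otimes ->
  is_completion iota -> crossed (fun x y => iota (otimes x y)).
Proof.
move=> [_ _ mul one] cross [iso _]; split.
- by move=> x x' y; rewrite linearBl rmorphB.
- by move=> x y y'; rewrite linearBr rmorphB.
- by move=> l m x y; rewrite linearZl_LR linearZr_LR scalerA linearZ.
- by move=> x x' y y'; rewrite -rmorphM mul.
- by rewrite one rmorph1.
- by move=> x y; rewrite /rnorm iso cross !rnormE -rmorphM.
Qed.

End CompletedTensor.

Theorem theorem3p2 (R : realType) (A B : banachAlgType R[i])
    (AB : normedAlgType R[i]) (otimes : {bilinear A -> B -> AB})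
    (T : banachAlgType R[i]) (iota : {lrmorphism AB -> T})
    (tensorAB : is_tensor_algebra otimes)
    (cross : crossnorm otimes) (unif : uniform_norm otimes)
    (compl : is_completion iota) (a : A) (b : B) :
  [/\ (* (i) *)
      (spectrum a = [set 0] /\ poles a = [set 0]) \/
      (spectrum b = [set 0] /\ poles b = [set 0]) <->
      (spectrum (iota (otimes a b)) = [set 0] /\
       poles (iota (otimes a b)) = [set 0]),
      (* (ii) *)
      ~ nilpotent_elt a -> ~ nilpotent_elt b ->
      ((spectrum a = [set 0] /\ nonpoles a = [set 0]) \/
       (spectrum b = [set 0] /\ nonpoles b = [set 0]) <->
       (spectrum (iota (otimes a b)) = [set 0] /\
        nonpoles (iota (otimes a b)) = [set 0])),
      (* (iii) *)
      (poles a 0 /\ b \is a GRing.unit) \/ (poles b 0 /\ a \is a GRing.unit) \/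
      (poles a `&` poles b) 0 ->
      poles (iota (otimes a b)) 0,
      (* (iv) *)
      (~ nilpotent_elt a -> poles a 0 -> nonpoles b 0 ->
       nonpoles (iota (otimes a b)) 0) /\
      (~ nilpotent_elt b -> poles b 0 -> nonpoles a 0 ->
       nonpoles (iota (otimes a b)) 0)
    & [/\ (* (v) *)
          (b \is a GRing.unit -> nonpoles a 0 ->
           nonpoles (iota (otimes a b)) 0) /\
          (a \is a GRing.unit -> nonpoles b 0 ->
           nonpoles (iota (otimes a b)) 0),
          (* (vi) *)
          (nonpoles a `&` nonpoles b) 0 -> nonpoles (iota (otimes a b)) 0
        & (* (vii) *)
          (spectrum b <> [set 0] -> acc (spectrum a) 0 ->
           acc (spectrum (iota (otimes a b))) 0) /\
          (spectrum a <> [set 0] -> acc (spectrum b) 0 ->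
           acc (spectrum (iota (otimes a b))) 0)]].
Proof.
pose ot x y := iota (otimes x y).
have H : crossed ot := crossed_completion tensorAB cross compl.
have Hf := crossed_flip H.
have sl : has_slices ot := completion_slices tensorAB cross unif compl.
have slf : has_slices (fun y x => ot x y).
  have [ot' [otE ten' cross' unif']] := tensor_flip tensorAB cross unif.
  have -> : (fun y x => ot x y) = (fun y x => iota (ot' y x)).
    by apply/funext => y; apply/funext => x; rewrite otE.
  exact: completion_slices ten' cross' unif' compl.
have nonpole_not_nilpotent (D : banachAlgType R[i]) (x : D) :
    nonpoles x 0 -> ~ nilpotent_elt x.
  by move=> /nonpoles0P[p [_ _ xp]] [n xn]; apply: (xp n); rewrite xn mul0r.
have spectral_of_nonpole (D : banachAlgType R[i]) (x : D) :
    nonpoles x 0 -> exists p, spectral_idem x p.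
  by move=> /nonpoles0P[p [_ xp _]]; exists p.
have unit_not_nilpotent (D : banachAlgType R[i]) (x : D) :
    x \is a GRing.unit -> ~ nilpotent_elt x.
  by move=> xu [n xn]; have := unitrX n xu; rewrite xn unitr0.
rewrite -/(ot a b); split; first by rewrite !nilpotentP -(nilpotent_crossed H).
- move=> na nb; have nc : ~ nilpotent_elt (ot a b) by move/(nilpotent_crossed H) => [].
  rewrite !qnil_nonpolesP //; split; last exact: crossed_qnil.
  by case=> q; [exact: qnil_crossedl H _ _ q | exact: qnil_crossedl Hf _ _ q].
- case=> [[/poles0P[p [n [p0 ap anp]]] bu]|[[/poles0P[q [n [q0 bq bnq]]] au]|]].
  (* An invertible element has spectral idempotent 0, which is killed already by the power of
     exponent 0. *)
  + apply: (crossed_pole H ap (unit_spectral_idem bu) p0 anp (m := 0%N)).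
    by rewrite mulr0.
  + apply: (crossed_pole Hf bq (unit_spectral_idem au) q0 bnq (m := 0%N)).
    by rewrite mulr0.
  + move=> [/poles0P[p [n [p0 ap anp]]] /poles0P[q [m [q0 bq bmq]]]].
    exact: (crossed_pole H ap bq p0 anp bmq).
- split=> [na /poles0P[p [_ [_ ap _]]] Ib|nb /poles0P[q [_ [_ bq _]]] Ia].
    exact: (crossed_nonpole H na ap Ib).
  exact: (crossed_nonpole Hf nb bq Ia).
split.
- split=> [bu Ia|au Ib].
    exact: (crossed_nonpole Hf (unit_not_nilpotent _ _ bu) (unit_spectral_idem bu) Ia).
  exact: (crossed_nonpole H (unit_not_nilpotent _ _ au) (unit_spectral_idem au) Ib).
- move=> [Ia Ib]; have [p ap] := spectral_of_nonpole _ _ Ia.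
  exact: (crossed_nonpole H (nonpole_not_nilpotent _ _ Ia) ap Ib).
- split=> [sb aa|sa ab].
    exact: (crossed_acc H sl sb aa).
  exact: (crossed_acc Hf slf sa ab).
Qed.
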